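(* For every constant $0<\varepsilon<1$ there exist constants $c,C>0$ (depending only on $\varepsilon$) such that for all integers $d\ge2$ and $n\ge1$ there is a distribution over $r\times n$ real matrices $\Pi$ with $r\le Cd^2$, such that every matrix in the support has at most two non-zero entries in each column, the expected number of non-zero entries in each column is at most $1+\varepsilon$, and for every fixed $A\in\mathbb{R}^{n\times d}$, with probability at least $0.99$, simultaneously for all $x\in\mathbb{R}^d$, $$c\log d\,\|Ax\|_1\le\|\Pi Ax\|_1\le Cd\log d\,\|Ax\|_1.$$
   Context: $\|y\|_1=\sum_i|y_i|$. The distribution depends only on $n,d,\varepsilon$, not on $A$. *)

(* Defs.v *)
From Stdlib Require Import Reals.
Open Scope R_scope.

Fixpoint rsum (m : nat) (f : nat -> R) : R :=
  match m with
  | O => 0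
  | S k => rsum k f + f k
  end.

(** Matrices are functions nat -> nat -> R (only entries in range matter);
    vectors are functions nat -> R. *)
Definition matvec (k : nat) (M : nat -> nat -> R) (v : nat -> R) : nat -> R :=
  fun i => rsum k (fun j => M i j * v j).

Definition norm1 (m : nat) (y : nat -> R) : R := rsum m (fun i => Rabs (y i)).

Fixpoint nnz_col (r : nat) (M : nat -> nat -> R) (j : nat) : nat :=
  match r with
  | O => O
  | S k => (nnz_col k M j + (if Req_EM_T (M k j) 0 then 0 else 1))%nat
  end.

Record prob_space := {
  sample : Type;
  meas : (sample -> Prop) -> Prop;
  prob : (sample -> Prop) -> R;
  meas_full : meas (fun _ => True);
  meas_compl : forall E, meas E -> meas (fun w => ~ E w);
  meas_cunion : forall E : nat -> sample -> Prop,
      (forall k, meas (E k)) -> meas (fun w => exists k, E k w);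
  prob_nonneg : forall E, meas E -> 0 <= prob E;
  prob_full : prob (fun _ => True) = 1;
  prob_cadd : forall E : nat -> sample -> Prop,
      (forall k, meas (E k)) ->
      (forall k l w, k <> l -> E k w -> E l w -> False) ->
      infinite_sum (fun k => prob (E k)) (prob (fun w => exists k, E k w))
}.

(** Expectation of the nat-valued simple random variable X with values in
    {0,...,K}:  sum_{k <= K} k * P(X = k). *)
Definition expect_nat (PS : prob_space) (K : nat) (X : sample PS -> nat) : R :=
  rsum (S K) (fun k => INR k * prob PS (fun w => X w = k)).

(* Main.v *)
(** A column j of the sketch has a fixed entry m ~ log d in a random row h(j) of
    a first block of r = O(d^2) rows, and, with probability at most eps, a
    signed entry +-W_j in row h(j) of a second block, where P(W_j = 2^k) =
    eps 2^-(k+1).  Everything is measured against one-sided Lewis weights w_j,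
    whose sum is at most d and which satisfy |y_j| <= 4 w_j |y|_1 on the column
    space of A.

    Upper bound: jumps with W_j w_j > d^O(1) do not occur, jumps with
    1/d^O(1) < W_j w_j are summed in absolute value (O(log d) dyadic scales), and
    the small ones cancel in second moment thanks to the signs.

    Lower bound: if half of |y|_1 sits on coordinates with large weight, the
    first block keeps it, because a coordinate rarely collides with a heavier one.
    Otherwise E|Pi_2 y|_1 >= c log d |y|_1: each of the log d scales of W_j w_j
    between two thresholds u0 and u1 contributes a constant, being alone in its
    bucket.  This holds for all y at once, without any net: symmetrization over
    buckets and the contraction principle reduce the deviation to
    sup_y |sum_j sigma_j W_j y_j| <= sum_i |y_i| |G_i|, where y_j = sum_i y_i v_ij
    is a reproducing kernel and G_i = sum_j sigma_j W_j v_ij; since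
    |y_i| <= 4 w_i |y|_1, the tails of the G_i are summed with the weights w_i,
    so the number n of rows plays no role. *)

From Stdlib Require Import Reals.
From mathcomp Require Import all_boot all_order all_algebra perm archimedean.
From mathcomp Require Import classical_sets boolp reals Rstruct sequences exp.
From mathcomp Require Import ring lra zify.
Require Import Defs.
Set Implicit Arguments. Unset Strict Implicit. Unset Printing Implicit Defensive.
Import Order.TTheory GRing.Theory Num.Theory.
Local Open Scope ring_scope.

(** The sample space is finite, so that all means are finite sums. Magnitudes are therefore cut off
    at [2 ^+ (K - 1)], where [K = n + 8] is large enough for every coordinate that matters: those
    with [w j < 1 / (128 n)] carry at most [1/32] of the norm. Finiteness also disposes of the
    supremum over [y]: a maximum over one worst [y] per outcome replaces it. The obstacle to
    concentration is the huge second moment of [W]. In the lower bound a bucket holding some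
    [W_j w_j > u1] is discarded, which can only shorten the sketch and leaves bounded summands. This
    event couples the coordinates of a bucket, but it depends on magnitudes only, so the signs stay
    independent given the magnitudes and exponential moments factorize. The mean of the second block
    grows with the number of scales, while the bound on its deviation does not; this leaves room for
    Markov's inequality. All failures are added into one nonnegative function of mean at most
    [1/100]. *)

(** * Cauchy-Schwarz and Bernoulli inequalities *)

Section FiniteSums.
Variable R : realType.

(** Lagrange's identity: the double sum of squared 2 x 2 minors is twice the difference of the two
    sides. *)
Lemma sum_mul_sqr_le (I : finType) (a b : I -> R) :
  (\sum_i a i * b i) ^+ 2 <= (\sum_i a i ^+ 2) * (\sum_i b i ^+ 2).
Proof.
have H : 0 <= \sum_i \sum_j (a i * b j - a j * b i) ^+ 2.
  by apply: sumr_ge0 => i _; apply: sumr_ge0 => j _; apply: sqr_ge0.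
have E : \sum_i \sum_j (a i * b j - a j * b i) ^+ 2 =
   2 * ((\sum_i a i ^+ 2) * (\sum_i b i ^+ 2)) - 2 * (\sum_i a i * b i) ^+ 2.
  have -> : (\sum_i a i * b i) ^+ 2 = \sum_i \sum_j (a i * b i) * (a j * b j).
    rewrite expr2 mulr_suml; apply: eq_bigr => i _.
    by rewrite mulr_sumr.
  have E1 : (\sum_i a i ^+ 2) * (\sum_i b i ^+ 2) = \sum_i \sum_j a i ^+ 2 * b j ^+ 2.
    by rewrite mulr_suml; apply: eq_bigr => i _; rewrite mulr_sumr.
  have E2 : (\sum_i a i ^+ 2) * (\sum_i b i ^+ 2) = \sum_i \sum_j a j ^+ 2 * b i ^+ 2.
    by rewrite E1 exchange_big.
  rewrite [2 * (_ * _)]mulr_natl mulr2n {1}E1 E2 mulr_sumr -sumrN -!big_split /=.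
  apply: eq_bigr => i _; rewrite mulr_sumr -sumrN -!big_split /=.
  by apply: eq_bigr => j _; ring.
by rewrite E in H; lra.
Qed.

Lemma bernoulli_le (a : R) k : 0 <= a -> a <= 1 -> 1 - k%:R * a <= (1 - a) ^+ k.
Proof.
move=> a0 a1; elim: k => [|k IH]; first by rewrite expr0 mul0r subr0.
rewrite exprS; apply: (@le_trans _ _ ((1 - a) * (1 - k%:R * a))).
  by rewrite -natr1; have : 0 <= k%:R :> R by []; nra.
by apply: ler_wpM2l => //; lra.
Qed.

End FiniteSums.

(** * Lewis weights *)

Section Lewis.
Variable R : realType.

Definition dot k (u v : 'rV[R]_k) : R := \sum_l u 0 l * v 0 l.

Lemma dotE k (u v : 'rV[R]_k) : u *m v^T = (dot u v)%:M.
Proof.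
by apply/matrixP => i j; rewrite !ord1 !mxE eqxx; apply: eq_bigr => l _; rewrite mxE.
Qed.

Lemma dotC k (u v : 'rV[R]_k) : dot u v = dot v u.
Proof. by apply: eq_bigr => l _; rewrite mulrC. Qed.

Lemma dotDl k (u u' v : 'rV[R]_k) : dot (u + u') v = dot u v + dot u' v.
Proof. by rewrite -big_split; apply: eq_bigr => l _; rewrite mxE mulrDl. Qed.

Lemma dotZl k c (u v : 'rV[R]_k) : dot (c *: u) v = c * dot u v.
Proof. by rewrite mulr_sumr; apply: eq_bigr => l _; rewrite mxE mulrA. Qed.

Lemma dotDr k (u v v' : 'rV[R]_k) : dot u (v + v') = dot u v + dot u v'.
Proof. by rewrite dotC dotDl !(dotC u). Qed.

Lemma dotZr k c (u v : 'rV[R]_k) : dot u (c *: v) = c * dot u v.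
Proof. by rewrite dotC dotZl dotC. Qed.

Lemma dot_suml k (J : finType) (P : pred J) (F : J -> 'rV[R]_k) u :
  dot (\sum_(j | P j) F j) u = \sum_(j | P j) dot (F j) u.
Proof.
rewrite [RHS]exchange_big; apply: eq_bigr => l _ /=.
by rewrite summxE mulr_suml.
Qed.

Lemma dotuu k (u : 'rV[R]_k) : dot u u = \sum_l u 0 l ^+ 2.
Proof. by apply: eq_bigr => l _; rewrite expr2. Qed.

Lemma dot_ge0 k (u : 'rV[R]_k) : 0 <= dot u u.
Proof. by rewrite dotuu; apply: sumr_ge0 => l _; apply: sqr_ge0. Qed.

Lemma dot_sqr_le k (u v : 'rV[R]_k) : dot u v ^+ 2 <= dot u u * dot v v.
Proof. by rewrite !dotuu; apply: sum_mul_sqr_le. Qed.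

Lemma dot_amgm k (a u : 'rV[R]_k) c : 0 < c ->
  2 * dot a u <= c * dot u u + dot a a / c.
Proof.
move=> c0; have := dot_ge0 (a - c *: u).
rewrite -scaleN1r scalerA mulN1r dotDl !dotDr !dotZl !dotZr (dotC u a) => h.
rewrite -(ler_pM2l c0) mulrDr mulrCA mulrC [c * (_ / c)]mulrCA mulfV ?gt_eqF //.
by lra.
Qed.

Lemma dot_eq0 k (u : 'rV[R]_k) : dot u u = 0 -> u = 0.
Proof.
rewrite dotuu => /eqP; rewrite psumr_eq0; last by move=> l _; apply: sqr_ge0.
move/allP => H; apply/rowP => l; rewrite mxE.
by apply/eqP; rewrite -sqrf_eq0; apply: H; rewrite mem_index_enum.
Qed.

(** Both block products in [E] equal the matrix with blocks [1, u, - u^T, 1]; the determinants of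
    the triangular factors give the two sides. *)
Lemma det_1D_rank1 k (u : 'rV[R]_k) : \det (1%:M + u^T *m u) = 1 + dot u u.
Proof.
have E : block_mx 1%:M 0 (- u^T) 1%:M *m block_mx 1%:M u 0 (1%:M + u^T *m u) =
         block_mx (1%:M + u *m u^T) u 0 1%:M *m block_mx 1%:M 0 (- u^T) 1%:M.
  rewrite !mulmx_block !mul1mx !mul0mx !mulmx0 !mulmx1 !addr0 !add0r.
  by congr block_mx; [rewrite mulmxN addrK | rewrite mulNmx addrC addrK].
have := congr1 determinant E.
rewrite !det_mulmx !det_lblock !det_ublock !det1 !mul1r !mulr1 => ->.
by rewrite dotE -raddfD /= det_scalar expr1.
Qed.

Definition nrm k (u : 'rV[R]_k) : R := Num.sqrt (dot u u).

Lemma nrm_ge0 k (u : 'rV[R]_k) : 0 <= nrm u. Proof. exact: sqrtr_ge0. Qed.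

Lemma nrm_sqr k (u : 'rV[R]_k) : nrm u ^+ 2 = dot u u.
Proof. by rewrite sqr_sqrtr ?dot_ge0. Qed.

Lemma nrm_le k (u : 'rV[R]_k) a : 0 <= a -> dot u u <= a ^+ 2 -> nrm u <= a.
Proof. by move=> a0 H; rewrite -(ler_pXn2r (n:=2)) ?nnegrE ?nrm_ge0 // nrm_sqr. Qed.

Lemma dot_le_nrm k (u v : 'rV[R]_k) : `|dot u v| <= nrm u * nrm v.
Proof.
rewrite -(ler_pXn2r (n:=2)) ?nnegrE ?mulr_ge0 ?nrm_ge0 //.
by rewrite exprMn !nrm_sqr real_normK ?num_real // dot_sqr_le.
Qed.

Lemma coord_le_nrm k (u : 'rV[R]_k) l : `|u 0 l| <= nrm u.
Proof.
rewrite -(ler_pXn2r (n:=2)) ?nnegrE ?nrm_ge0 // nrm_sqr dotuu real_normK ?num_real //.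
by rewrite (bigD1 l) //= lerDl; apply: sumr_ge0 => i _; apply: sqr_ge0.
Qed.

Lemma nrmZ k c (u : 'rV[R]_k) : 0 <= c -> nrm (c *: u) = c * nrm u.
Proof.
move=> c0; rewrite /nrm dotZl dotZr mulrA -expr2 sqrtrM ?sqr_ge0 //.
by rewrite sqrtr_sqr ger0_norm.
Qed.

Variables n k : nat.
Variable B : 'M[R]_(n, k).
Hypothesis Bfull : row_full B.

(** Constraint of Lewis's extremal problem for the 1-norm: the weights will be the row norms of
    [B *m T] for a feasible [T] of nearly maximal determinant. *)
Let feas (T : 'M[R]_k) := \sum_j nrm (row j (B *m T)) <= k%:R.

(** A left inverse [Q] of [B] recovers [T = Q *m (B *m T)], so the constraint bounds every entry of
    [T], and Leibniz's formula bounds the determinant. *)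
Lemma det_feas_bounded : exists K : R, forall T, feas T -> `|\det T| <= K.
Proof.
case/row_fullP: Bfull => Q QB.
pose c := (\sum_i \sum_j `|Q i j|) * k%:R.
exists ((k`!)%:R * c ^+ k) => T HT.
have HE i l : `|T i l| <= c.
  have -> : T = Q *m (B *m T) by rewrite mulmxA QB mul1mx.
  rewrite mxE; apply: (le_trans (ler_norm_sum _ _ _)).
  apply: (@le_trans _ _ (\sum_j `|Q i j| * k%:R)).
    apply: ler_sum => j _; rewrite normrM; apply: ler_wpM2l => //.
    have -> : (B *m T) j l = row j (B *m T) 0 l by rewrite [RHS]mxE.
    apply: (le_trans (coord_le_nrm _ _)); apply: le_trans HT.
    by rewrite (bigD1 j) //= lerDl; apply: sumr_ge0 => ? _; apply: nrm_ge0.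
  rewrite -mulr_suml; apply: ler_wpM2r => //.
  rewrite [X in _ <= X](bigD1 i) //= lerDl.
  by apply: sumr_ge0 => ? _; apply: sumr_ge0.
rewrite /determinant; apply: (le_trans (ler_norm_sum _ _ _)).
apply: (@le_trans _ _ (\sum_(s : 'S_k) c ^+ k)).
  apply: ler_sum => s _; rewrite normrM normrX normrN1 expr1n mul1r normr_prod.
  apply: (@le_trans _ _ (\prod_(i < k) c)).
    by apply: ler_prod => i _; rewrite normr_ge0 HE.
  by rewrite prodr_const card_ord.
by rewrite sumr_const card_Sn mulr_natl.
Qed.

(* A feasible T whose |det| is within a factor 5/4 of the supremum suffices:
   if the Lewis quadratic form of B T were at most 1/4 in some unit direction e,
   stretching by 2 along e and rescaling would gain more than 5/4. *)
Lemma exists_near_max_det : exists T : 'M[R]_k,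
  [/\ feas T, \det T != 0 & forall T', feas T' -> 4 * `|\det T'| < 5 * `|\det T|].
Proof.
have [K HK] := det_feas_bounded.
pose E := [set x : R | exists2 T, feas T & x = `|\det T|]%classic.
have [T0 fT0 dT0] : exists2 T0, feas T0 & 0 < `|\det T0|.
  pose s := \sum_j nrm (row j B).
  have s0 : 0 <= s by apply: sumr_ge0 => j _; apply: nrm_ge0.
  case: (posnP k) => [k0|k0].
    exists 1%:M; last by rewrite det1 normr1.
    rewrite /feas big1 // => j _; rewrite /nrm [dot _ _]big1 ?sqrtr0 // => l _.
    by have := ltn_ord l; rewrite [X in (_ < X)%N]k0 ltn0.
  pose t := k%:R / (1 + s).
  have t0 : 0 < t by apply: divr_gt0; [rewrite ltr0n | lra].
  exists t%:M; last by rewrite det_scalar normr_gt0 expf_neq0 // gt_eqF.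
  rewrite /feas.
  under eq_bigr => j _ do rewrite mul_mx_scalar linearZ /= nrmZ ?ltW //.
  rewrite -mulr_sumr -/s /t mulrAC ler_pdivrMr; last lra.
  by have : 0 <= k%:R :> R by []; nra.
have hs : has_sup E.
  split; first by exists `|\det T0|; exists T0.
  by exists K => x [T fT ->]; apply: HK.
have supT T : feas T -> `|\det T| <= sup E.
  by move=> fT; apply: ub_le_sup; [case: hs | exists T].
have sp : 0 < sup E by apply: (lt_le_trans dT0); apply: supT.
have [|x [T fT ->] Hx] := @sup_adherent _ E (sup E / 5) _ hs; first lra.
exists T; split => //.
  by rewrite -normr_gt0; lra.
by move=> T' /supT H'; lra.
Qed.

(** Gram form of the rows of [B *m T], each row divided by the square root of its weight. A zero row
    contributes 0, since division by 0 yields 0. *)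
Definition lform (T : 'M[R]_k) (u : 'rV[R]_k) : R :=
  \sum_j dot (row j (B *m T)) u ^+ 2 / nrm (row j (B *m T)).

Lemma lform_ge T : feas T ->
    (forall T', feas T' -> 4 * `|\det T'| < 5 * `|\det T|) ->
  forall u, dot u u <= 4 * lform T u.
Proof.
move=> fT maxT.
have unit_case e : dot e e = 1 -> 1 <= 4 * lform T e.
  move=> e1; rewrite leNgt; apply/negP => lt1.
  set la := lform T e in lt1.
  pose b j := row j (B *m T).
  have k0 : (0 < k)%N.
    case: (posnP k) => // k0; move: e1; rewrite /dot big1 => [/eqP|l _].
      by rewrite eq_sym oner_eq0.
    by have := ltn_ord l; rewrite [X in (_ < X)%N]k0 ltn0.
  have kR : 1 <= k%:R :> R by rewrite ler1n.
  (* [a] solves [(1 - a) * (k + 3/8) = k], which restores feasibility after the stretch. Then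
     [k * a <= 3/8], and by Bernoulli the determinant gains at least [2 * 5/8 = 5/4]. *)
  pose a : R := 3 / 8 / (k%:R + 3 / 8).
  have a0 : 0 <= a by apply: divr_ge0; lra.
  have ka : a * (k%:R + 3 / 8) = 3 / 8 by rewrite /a divfK //; lra.
  have a1 : a <= 1 by nra.
  pose T' := (1 - a) *: (T *m (1%:M + e^T *m e)).
  have rowT' j : row j (B *m T') = (1 - a) *: (b j + dot (b j) e *: e).
    rewrite /T' -scalemxAr linearZ /= mulmxA mulmxDr mulmx1 raddfD /= -/(b j).
    by rewrite mulmxA row_mul row_mul -/(b j) dotE mul_scalar_mx.
  have fT' : feas T'.
    rewrite /feas.
    under eq_bigr => j _ do rewrite rowT' nrmZ ?subr_ge0 //.
    rewrite -mulr_sumr.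
    (* With [w = nrm (b j)] and [q = dot (b j) e], the stretched row has squared norm
       [w^2 + 3 q^2 <= (w + 3 q^2 / (2 w))^2]. *)
    have H : \sum_j nrm (b j + dot (b j) e *: e) <= k%:R + 3 / 2 * la.
      apply: (@le_trans _ _ (\sum_j (nrm (b j) + 3 / 2 * (dot (b j) e ^+ 2 / nrm (b j))))).
        apply: ler_sum => j _.
        have w0 := nrm_ge0 (b j).
        have := dot_le_nrm (b j) e.
        have -> : nrm e = 1 by rewrite /nrm e1 sqrtr1.
        rewrite mulr1 => Hq.
        set q := dot (b j) e in Hq *.
        have [w1|w1] := ltP 0 (nrm (b j)).
          apply: nrm_le; first by rewrite addr_ge0 // mulr_ge0 ?divr_ge0 ?sqr_ge0.
          rewrite dotDl !dotDr !dotZl !dotZr e1 -nrm_sqr (dotC e) -/q.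
          set w := nrm (b j) in w0 w1 *.
          have wz : (q ^+ 2 / w) * w = q ^+ 2 by rewrite divfK // gt_eqF.
          set z := q ^+ 2 / w in wz *.
          have z0 : 0 <= z by apply: divr_ge0 => //; apply: sqr_ge0.
          nra.
        have w2 : nrm (b j) = 0 by apply/eqP; rewrite eq_le w1 w0.
        have q2 : q = 0 by apply/eqP; rewrite -normr_le0 (le_trans Hq) // w2.
        by rewrite q2 scale0r addr0 expr0n mul0r mulr0 addr0.
      by rewrite big_split /= -mulr_sumr lerD2r.
    apply: (@le_trans _ _ ((1 - a) * (k%:R + 3 / 8))).
      by apply: ler_wpM2l; [lra | apply: (le_trans H); lra].
    nra.
  have := maxT _ fT'.
  rewrite /T' detZ det_mulmx det_1D_rank1 e1 !normrM.
  have -> : `|1 + 1| = 2 :> R by rewrite ger0_norm; lra.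
  rewrite ger0_norm; last by apply: exprn_ge0; lra.
  have bern := @bernoulli_le R a k a0 a1.
  have h : 5 / 8 <= (1 - a) ^+ k by apply: le_trans bern; nra.
  have : 0 <= `|\det T| by [].
  by nra.
move=> u; have [->|u0] := eqVneq (dot u u) 0.
  apply: mulr_ge0 => //; apply: sumr_ge0 => j _.
  by apply: divr_ge0; [apply: sqr_ge0 | apply: nrm_ge0].
have up : 0 < dot u u by rewrite lt_neqAle eq_sym u0 dot_ge0.
pose s := (nrm u)^-1.
have ss : s ^+ 2 * dot u u = 1.
  by rewrite -nrm_sqr -exprMn mulVf ?expr1n // /nrm gt_eqF // sqrtr_gt0.
have := unit_case (s *: u).
rewrite dotZl dotZr mulrA -expr2 ss => /(_ erefl).
have -> : lform T (s *: u) = s ^+ 2 * lform T u.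
  rewrite /lform mulr_sumr; apply: eq_bigr => j _.
  by rewrite dotZr exprMn -mulrA.
move=> /(ler_wpM2l (ltW up)).
have -> : dot u u * (4 * (s ^+ 2 * lform T u)) = 4 * lform T u * (s ^+ 2 * dot u u).
  by ring.
by rewrite ss !mulr1.
Qed.

End Lewis.

(* One-sided Lewis weights of a set V of vectors: w_j = |b_j|, where y_j = <b_j, x>
   parametrizes V, and v is a kernel reproducing V. *)
Record lewis_weights (R : realType) n k (V : ('I_n -> R) -> Prop) (d : R)
    (b : 'I_n -> 'rV[R]_k) (w : 'I_n -> R) (v : 'I_n -> 'I_n -> R) : Prop := {
  lw_ge0 : forall j, 0 <= w j;
  lw_norm : forall j, dot (b j) (b j) = w j ^+ 2;
  lw_sum : \sum_j w j <= d;
  lw_ker_le : forall i j, `|v i j| <= 4 * w j;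
  lw_ker_sum : forall i, \sum_j v i j ^+ 2 / w j <= 4;
  lw_repr : forall y, V y -> forall j, y j = \sum_i y i * v i j;
  lw_coord : forall y, V y -> exists2 x : 'rV[R]_k,
    (forall j, y j = dot (b j) x) & dot x x <= 16 * (\sum_j `|y j|) ^+ 2
}.

(** A column basis of [A] supplies the full rank that the extremal problem needs; the weights then
    sum to at most the rank. Only the lower bound [lform_ge] on the Gram form is used: it inverts
    [M], and every 4 and 16 below comes from its constant 4. *)
Lemma exists_lewis_weights (R : realType) n d (A : 'M[R]_(n, d)) :
  exists k (b : 'I_n -> 'rV[R]_k) w v,
    lewis_weights (fun y => exists x : 'cV_d, forall j, y j = (A *m x) j 0) d%:R b w v.
Proof.
pose B := col_base A; pose k := \rank A.
have Bfull : row_full B by apply: col_base_full.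
have [T [fT dT maxT]] := exists_near_max_det Bfull.
have Q := lform_ge fT maxT.
pose b j := row j (B *m T); pose w j := nrm (b j).
have w0 j : 0 <= w j by apply: nrm_ge0.
pose M : 'M[R]_k := \sum_j (w j)^-1 *: ((b j)^T *m b j).
have MT : M^T = M.
  rewrite /M raddf_sum; apply: eq_bigr => j _ /=.
  by rewrite linearZ /= trmx_mul trmxK.
have uM (u : 'rV_k) : u *m M = \sum_j (dot (b j) u / w j) *: b j.
  rewrite mulmx_sumr; apply: eq_bigr => j _.
  by rewrite -scalemxAr mulmxA dotE mul_scalar_mx scalerA mulrC dotC.
have uMu u : dot (u *m M) u = lform B T u.
  by rewrite uM dot_suml; apply: eq_bigr => j _; rewrite dotZl mulrAC -expr2.
have Munit : M \in unitmx.
  rewrite -row_free_unit -kermx_eq0; apply/eqP/row_matrixP => i.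
  rewrite row0; set u := row i _.
  have uM0 : u *m M = 0 by rewrite /u -row_mul mulmx_ker row0.
  have := Q u; rewrite -uMu uM0 /dot [in X in _ <= X]big1; last first.
    by move=> l _; rewrite mxE mul0r.
  rewrite mulr0 => H; apply: dot_eq0; apply/eqP.
  by rewrite eq_le H dot_ge0.
(* The kernel is [v i j = dot (b j) (u i)] with [u i = a i *m invmx M]. It reproduces
   [y j = dot (b j) z] because the sum of [y i *: a i] is [z *m M]. *)
pose a i := (w i)^-1 *: b i.
pose u i := a i *m invmx M.
have uaM i : u i *m M = a i by rewrite /u mulmxKV.
have sqa i : dot (a i) (a i) <= 1.
  rewrite /a dotZl dotZr mulrA -nrm_sqr -/(w i).
  have [->|wi] := eqVneq (w i) 0; first by rewrite expr0n mulr0.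
  by rewrite -expr2 -exprMn mulVf // expr1n.
(* At [c = 1/4] this bound competes with [dot (u i) (u i) <= 4 * dot (a i) (u i)], which yields
   [squ] and then [au4]. *)
have amgm i c : 0 < c -> 2 * dot (a i) (u i) <= c * dot (u i) (u i) + c^-1.
  move=> c0; apply: (le_trans (dot_amgm (a i) (u i) c0)); rewrite lerD2l.
  by rewrite ler_piMl ?sqa // invr_ge0 ltW.
have au i : dot (a i) (u i) = lform B T (u i) by rewrite -uMu uaM.
have squ i : dot (u i) (u i) <= 16.
  by have := Q (u i); have := @amgm i (1/4); rewrite au; lra.
have au4 i : dot (a i) (u i) <= 4.
  by have := squ i; have := @amgm i (1/4); lra.
have coords y : (exists x : 'cV_d, forall j, y j = (A *m x) j 0) ->
    exists z : 'rV[R]_k, forall j, y j = dot (b j) z.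
  move=> [x Hx]; exists (invmx T *m (row_base A *m x))^T => j; set z := _^T.
  have Tu : T \in unitmx by rewrite unitmxE unitfE.
  have E : A *m x = B *m T *m z^T.
    by rewrite trmxK mulmxA mulmxK // mulmxA mulmx_base.
  rewrite Hx E; have := dotE (b j) z; rewrite /b -row_mul => /matrixP/(_ 0 0).
  by rewrite mxE => ->; rewrite mxE eqxx.
exists k, b, w, (fun i j => dot (b j) (u i)); split => //.
- by move=> j; rewrite nrm_sqr.
- by apply: (le_trans fT); rewrite ler_nat rank_leq_col.
- move=> i j; apply: (le_trans (dot_le_nrm (b j) (u i))).
  have H : nrm (u i) <= 4 by apply: nrm_le => //; apply: (le_trans (squ i)); lra.
  by rewrite [X in X <= _]mulrC; apply: (ler_wpM2r (w0 j)).
- by move=> i; apply: le_trans (au4 i); rewrite au.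
- move=> y /coords[z Hz].
  move=> j; rewrite Hz.
  have -> : \sum_i y i * dot (b j) (u i) = dot (b j) (\sum_i (y i *: u i)).
    by rewrite [RHS]dotC dot_suml; apply: eq_bigr => i _; rewrite dotZl dotC.
  congr dot; apply: (can_inj (mulmxK Munit)).
  rewrite uM mulmx_suml; apply: eq_bigr => i _.
  by rewrite -scalemxAl uaM /a scalerA Hz.
- move=> y /coords[z Hz].
  exists z => //.
  have s0 : 0 <= \sum_j `|y j| by apply: sumr_ge0.
  have H : dot z z <= 4 * (nrm z * \sum_j `|y j|).
    apply: (le_trans (Q z)); rewrite ler_pM2l // /lform mulr_sumr.
    apply: ler_sum => j _; rewrite -/(b j) -/(w j) -Hz.
    have [->|wj] := eqVneq (w j) 0; first by rewrite invr0 mulr0 mulr_ge0 ?nrm_ge0.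
    have wp : 0 < w j by rewrite lt_neqAle eq_sym wj w0.
    rewrite ler_pdivrMr // -[y j ^+ 2]real_normK ?num_real // expr2 mulrAC.
    apply: ler_wpM2r => //; rewrite mulrC Hz; exact: dot_le_nrm.
  rewrite -nrm_sqr in H *; have := nrm_ge0 z; set t := nrm z in H * => t0.
  have t4 : t <= 4 * \sum_j `|y j|.
    have [t1|t1] := ltP 0 t; last by apply: (le_trans t1); lra.
    by rewrite -(ler_pM2l t1); lra.
  by nra.
Qed.

(** * Finite product measures *)

Section ProductMeasure.
Variables (R : realType) (T : finType) (p : T -> R).
Hypothesis p_ge0 : forall t, 0 <= p t.
Hypothesis p_sum1 : \sum_t p t = 1.

Definition mean1 (f : T -> R) : R := \sum_t p t * f t.

Lemma mean1_cst c : mean1 (fun=> c) = c.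
Proof. by rewrite /mean1 -mulr_suml p_sum1 mul1r. Qed.

Lemma mean1Zr c f : mean1 (fun t => f t * c) = mean1 f * c.
Proof. by rewrite /mean1 mulr_suml; apply: eq_bigr => t _; rewrite mulrA. Qed.

Lemma mean1Zl c f : mean1 (fun t => c * f t) = c * mean1 f.
Proof. by rewrite /mean1 mulr_sumr; apply: eq_bigr => t _; rewrite mulrCA. Qed.

Lemma mean1D f g : mean1 (fun t => f t + g t) = mean1 f + mean1 g.
Proof. by rewrite /mean1 -big_split; apply: eq_bigr => t _; rewrite mulrDr. Qed.

Lemma mean1_le f g : (forall t, f t <= g t) -> mean1 f <= mean1 g.
Proof. by move=> fg; apply: ler_sum => t _; apply: ler_wpM2l. Qed.

Lemma mean1_ge0 f : (forall t, 0 <= f t) -> 0 <= mean1 f.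
Proof. by move=> f0; apply: sumr_ge0 => t _; apply: mulr_ge0. Qed.

Variable I : finType.
Implicit Types (F G : {ffun I -> T} -> R) (f g : {ffun I -> T}).

Definition pweight f : R := \prod_i p (f i).

Definition mean F : R := \sum_f pweight f * F f.

Lemma pweight_ge0 f : 0 <= pweight f.
Proof. by apply: prodr_ge0. Qed.

Lemma mean_prod (G : I -> T -> R) :
  mean (fun f => \prod_i G i (f i)) = \prod_i mean1 (G i).
Proof.
rewrite /mean /mean1 bigA_distr_bigA /=; apply: eq_bigr => f _.
by rewrite -big_split.
Qed.

Lemma eq_mean F G : F =1 G -> mean F = mean G.
Proof. by move=> FG; apply: eq_bigr => f _; rewrite FG. Qed.

Lemma pweight_sum1 : \sum_f pweight f = 1.
Proof.
rewrite /pweight -(bigA_distr_bigA (fun _ : I => p)) /=.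
by apply: big1 => i _; apply: p_sum1.
Qed.

Lemma mean_cst c : mean (fun=> c) = c.
Proof. by rewrite /mean -mulr_suml pweight_sum1 mul1r. Qed.

Lemma meanD F G : mean (fun f => F f + G f) = mean F + mean G.
Proof. by rewrite /mean -big_split; apply: eq_bigr => t _; rewrite mulrDr. Qed.

Lemma meanZl c F : mean (fun f => c * F f) = c * mean F.
Proof. by rewrite /mean mulr_sumr; apply: eq_bigr => t _; rewrite mulrCA. Qed.

Lemma meanZr c F : mean (fun f => F f * c) = mean F * c.
Proof. by rewrite /mean mulr_suml; apply: eq_bigr => t _; rewrite mulrA. Qed.

Lemma mean_sum (J : finType) (P : pred J) (F : J -> {ffun I -> T} -> R) :
  mean (fun f => \sum_(j | P j) F j f) = \sum_(j | P j) mean (F j).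
Proof.
rewrite /mean exchange_big /=; apply: eq_bigr => f _.
by rewrite mulr_sumr.
Qed.

Lemma mean_le F G : (forall f, F f <= G f) -> mean F <= mean G.
Proof. by move=> FG; apply: ler_sum => f _; apply: ler_wpM2l => //; apply: pweight_ge0. Qed.

Lemma mean_ge0 F : (forall f, 0 <= F f) -> 0 <= mean F.
Proof. by move=> F0; apply: sumr_ge0 => f _; rewrite mulr_ge0 ?pweight_ge0. Qed.

Definition mix (a : pred I) f g : {ffun I -> T} := [ffun i => if a i then f i else g i].

(** Two independent copies may trade any fixed set of coordinates. Trading one coordinate gives
    resampling; trading whole buckets gives symmetrization. *)
Lemma mean_swap (a : pred I) (H : {ffun I -> T} -> {ffun I -> T} -> R) :
  mean (fun f => mean (fun g => H f g)) =
  mean (fun f => mean (fun g => H (mix a f g) (mix a g f))).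
Proof.
have E K : mean (fun f => mean (fun g => K f g)) =
    \sum_(x : {ffun I -> T} * {ffun I -> T}) pweight x.1 * pweight x.2 * K x.1 x.2.
  rewrite /mean -(pair_big xpredT xpredT
    (fun f g => pweight f * pweight g * K f g)) /=.
  by apply: eq_bigr => f _; rewrite mulr_sumr; apply: eq_bigr => g _; rewrite mulrA.
pose s (x : {ffun I -> T} * {ffun I -> T}) := (mix a x.1 x.2, mix a x.2 x.1).
have sK : involutive s.
  move=> [f g]; rewrite /s /=; congr (_, _); apply/ffunP => i; rewrite !ffunE;
  by case: (a i).
rewrite !E (reindex_inj (inv_inj sK)) /=; apply: eq_bigr => -[f g] _ /=.
congr (_ * _); rewrite /pweight -!big_split; apply: eq_bigr => i _ /=.
by rewrite !ffunE; case: (a i); rewrite // mulrC.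
Qed.

Lemma mean_coord i (F : T -> R) : mean (fun f => F (f i)) = mean1 F.
Proof.
pose G j t := if j == i then F t else 1.
have E f : F (f i) = \prod_j G j (f j).
  by rewrite (bigD1 i) //= /G eqxx big1 ?mulr1 // => j /negPf ->.
rewrite (eq_mean E) mean_prod (bigD1 i) //= big1 /G ?eqxx ?mulr1 // => j /negPf ->.
exact: mean1_cst.
Qed.

Definition upd f i t : {ffun I -> T} := [ffun j => if j == i then t else f j].

Lemma mean_resample i F : mean F = mean (fun f => mean1 (fun t => F (upd f i t))).
Proof.
transitivity (mean (fun f => mean (fun g => F f))).
  by apply: eq_mean => f; rewrite mean_cst.
rewrite (mean_swap (predC1 i)); apply: eq_mean => f.
rewrite -(mean_coord i (fun t => F (upd f i t))).
apply: eq_mean => g; congr F; apply/ffunP => j; rewrite !ffunE /=.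
by case: eqVneq => //= ->.
Qed.

Lemma mean_coord2 i j (F G : T -> R) : i != j ->
  mean (fun f => F (f i) * G (f j)) = mean1 F * mean1 G.
Proof.
move=> ij; rewrite (mean_resample i) -(mean_coord j G) -meanZl.
apply: eq_mean => f; rewrite -mean1Zr; apply: eq_bigr => t _.
by rewrite !ffunE eqxx eq_sym (negPf ij).
Qed.

Lemma mean_reindex (phi : I -> T -> T) F :
    (forall i, injective (phi i)) -> (forall i t, p (phi i t) = p t) ->
  mean F = mean (fun f => F [ffun i => phi i (f i)]).
Proof.
move=> phi_inj pphi; rewrite /mean.
have inj : injective (fun f => [ffun i => phi i (f i)] : {ffun I -> T}).
  move=> f g /ffunP E; apply/ffunP => i; apply: (phi_inj i).
  by have := E i; rewrite !ffunE.
rewrite (reindex_inj inj) /=; apply: eq_bigr => f _; congr (_ * _).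
by apply: eq_bigr => i _; rewrite ffunE pphi.
Qed.

End ProductMeasure.

Lemma mean_exchange (R : realType) (T U I J : finType) (p : T -> R) (q : U -> R)
    (F : {ffun I -> T} -> {ffun J -> U} -> R) :
  mean p (fun f => mean q (fun g => F f g)) = mean q (fun g => mean p (fun f => F f g)).
Proof.
rewrite /mean; under eq_bigr do rewrite mulr_sumr.
rewrite exchange_big /=; apply: eq_bigr => g _; rewrite mulr_sumr.
by apply: eq_bigr => f _; rewrite mulrCA.
Qed.

(** * Maxima over a finite index set *)

Section FiniteMax.
Variables (R : realType) (J : finType) (j0 : J).
Implicit Types F G : J -> R.

Definition fmax F : R := F [arg max_(j > j0) F j]%O.

Lemma le_fmax F j : F j <= fmax F.
Proof. by rewrite /fmax; case: arg_maxP => // i _; apply. Qed.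

Lemma fmax_le F c : (forall j, F j <= c) -> fmax F <= c.
Proof. by move=> H; apply: H. Qed.

Lemma fmaxD F G : fmax (fun j => F j + G j) <= fmax F + fmax G.
Proof. by apply: fmax_le => j; apply: lerD; apply: le_fmax. Qed.

Lemma eq_fmax F G : F =1 G -> fmax F = fmax G.
Proof.
by move=> FG; apply/eqP; rewrite eq_le !fmax_le // => j; rewrite ?FG ?le_fmax // -FG le_fmax.
Qed.

(** Let [i] and [j] attain the two maxima on the left. Since [|G i| - |G j| <= |G i - G j|], the
    sign of [G i - G j] tells which of them to insert with [+] on the right and which with [-]. *)
Lemma fmax_abs_le F G :
  fmax (fun j => F j + `|G j|) + fmax (fun j => F j - `|G j|) <=
  fmax (fun j => F j + G j) + fmax (fun j => F j - G j).
Proof.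
have key i j : F i + `|G i| + (F j - `|G j|) <=
    fmax (fun j => F j + G j) + fmax (fun j => F j - G j).
  have h1 := le_fmax (fun j => F j + G j); have h2 := le_fmax (fun j => F j - G j).
  have := lerB_dist (G i) (G j); have [h|h] := leP 0 (G i - G j).
    by rewrite (ger0_norm h); have := h1 i; have := h2 j; lra.
  by rewrite (ltr0_norm h); have := h1 j; have := h2 i; lra.
by rewrite {1}/fmax {1}/fmax; apply: key.
Qed.

End FiniteMax.

(** * Contraction and symmetrization *)

Section Symmetrization.
Variable R : realType.

Definition coin (_ : bool) : R := 2^-1.
Definition sgn (b : bool) : R := (-1) ^+ b.

Lemma coin_ge0 b : 0 <= coin b. Proof. by rewrite invr_ge0. Qed.
Lemma coin_sum1 : \sum_b coin b = 1.
Proof. by rewrite big_bool /coin /=; lra. Qed.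

Lemma mean1_coin F : mean1 coin F = (F true + F false) / 2.
Proof. by rewrite /mean1 big_bool /coin /=; lra. Qed.

Variables (B J : finType) (j0 : J).
Local Notation fmax := (fmax j0).

Lemma contraction_step b0 (v : J -> B -> R) :
  mean coin (fun s => fmax (fun j =>
     \sum_b sgn (s b) * (if b == b0 then `|v j b| else v j b))) <=
  mean coin (fun s => fmax (fun j => \sum_b sgn (s b) * v j b)).
Proof.
rewrite (mean_resample coin_sum1 b0) [X in _ <= X](mean_resample coin_sum1 b0).
apply: (mean_le coin_ge0) => s; rewrite !mean1_coin ler_pM2r ?invr_gt0 //.
pose A j := \sum_(b | b != b0) sgn (s b) * v j b.
have E1 t j : \sum_b sgn (upd s b0 t b) * (if b == b0 then `|v j b| else v j b)
     = A j + sgn t * `|v j b0|.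
  rewrite (bigD1 b0) //= ffunE eqxx addrC; congr (_ + _).
  by apply: eq_bigr => b /negPf nb; rewrite ffunE nb.
have E2 t j : \sum_b sgn (upd s b0 t b) * v j b = A j + sgn t * v j b0.
  rewrite (bigD1 b0) //= ffunE eqxx addrC; congr (_ + _).
  by apply: eq_bigr => b /negPf nb; rewrite ffunE nb.
rewrite !(eq_fmax _ (E1 _)) !(eq_fmax _ (E2 _)).
have := fmax_abs_le j0 A (fun j => v j b0); rewrite addrC [X in _ <= X]addrC.
congr (_ + _ <= _ + _); apply: eq_fmax => j; rewrite /sgn ?expr1 ?expr0 ?mulN1r ?mul1r //.
Qed.

(** Rademacher contraction for the absolute value. There is no factor 2, because the maximum carries
    no outer absolute value; the inner ones are inserted one index at a time. *)
Lemma contraction (v : J -> B -> R) :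
  mean coin (fun s => fmax (fun j => \sum_b sgn (s b) * `|v j b|)) <=
  mean coin (fun s => fmax (fun j => \sum_b sgn (s b) * v j b)).
Proof.
suff H (r : seq B) : mean coin (fun s => fmax (fun j =>
       \sum_b sgn (s b) * (if b \in r then `|v j b| else v j b))) <=
     mean coin (fun s => fmax (fun j => \sum_b sgn (s b) * v j b)).
  apply: le_trans (H (enum B)); rewrite le_eqVlt; apply/orP; left; apply/eqP.
  apply: eq_mean => s; apply: eq_fmax => j; apply: eq_bigr => b _.
  by rewrite mem_enum.
elim: r => [|b0 r IH].
  rewrite le_eqVlt; apply/orP; left; apply/eqP.
  by apply: eq_mean => s; apply: eq_fmax => j; apply: eq_bigr.
apply: le_trans IH; apply: le_trans (contraction_step b0 _).
rewrite le_eqVlt; apply/orP; left; apply/eqP.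
apply: eq_mean => s; apply: eq_fmax => j; apply: eq_bigr => b _.
by rewrite inE; case: eqVneq => //= _; case: ifP; rewrite ?normr_id.
Qed.

Variables (I T : finType) (p : T -> R).
Hypothesis p_ge0 : forall t, 0 <= p t.
Hypothesis p_sum1 : \sum_t p t = 1.
Variables (h : I -> B) (g : J -> B -> {ffun I -> T} -> R).
Hypothesis g_loc : forall j b (f f' : {ffun I -> T}),
  (forall i, h i = b -> f i = f' i) -> g j b f = g j b f'.

(** By [g_loc] a bucket sees only the coordinates hashed to it, so two copies can be exchanged
    bucket by bucket and a random sign per bucket costs nothing. Each copy accounts for one half of
    the factor 2, and [contraction] removes the absolute values. *)
Lemma symmetrization :
  mean p (fun f => fmax (fun j =>
    \sum_b (mean p (fun f' => `|g j b f'|) - `|g j b f|))) <=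
  2 * mean coin (fun s => mean p (fun f => fmax (fun j => \sum_b sgn (s b) * g j b f))).
Proof.
pose D (s : {ffun B -> bool}) f f' :=
  fmax (fun j => \sum_b sgn (s b) * (`|g j b f'| - `|g j b f|)).
have D_eq s : mean p (fun f => mean p (fun f' => D s f f')) =
              mean p (fun f => mean p (fun f' => D [ffun=> false] f f')).
  rewrite [RHS](mean_swap _ (fun i => ~~ s (h i))).
  apply: eq_mean => f; apply: eq_mean => f'; apply: eq_fmax => j.
  apply: eq_bigr => b _; rewrite ffunE /sgn expr0 mul1r.
  case sb: (s b); rewrite ?expr1 ?expr0 ?mulN1r ?mul1r ?opprB.
    by congr (_ - _); congr Num.norm; apply: g_loc => i hi; rewrite ffunE hi sb.
  by congr (_ - _); congr Num.norm; apply: g_loc => i hi; rewrite ffunE hi sb.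
apply: (@le_trans _ _ (mean p (fun f => mean p (fun f' => D [ffun=> false] f f')))).
  apply: mean_le => // f; apply: fmax_le => j.
  have -> : \sum_b (mean p (fun f' => `|g j b f'|) - `|g j b f|) =
     mean p (fun f' => \sum_b (`|g j b f'| - `|g j b f|)).
    rewrite mean_sum; apply: eq_bigr => b _; rewrite meanD; congr (_ + _).
    by rewrite mean_cst.
  apply: mean_le => // f'; apply: le_trans (le_fmax _ _ j) => /=.
  by apply: ler_sum => b _; rewrite ffunE /sgn expr0 mul1r.
apply: (@le_trans _ _ (mean coin (fun s => mean p (fun f => mean p (fun f' => D s f f'))))).
  by under [X in _ <= X]eq_mean do rewrite D_eq; rewrite mean_cst ?coin_sum1.
pose X s f := fmax (fun j => \sum_b sgn (s b) * `|g j b f|).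
pose neg (s : {ffun B -> bool}) : {ffun B -> bool} := [ffun b => ~~ s b].
apply: (@le_trans _ _ (mean coin (fun s => mean p (fun f => mean p (fun f' => X s f' + X (neg s) f))))).
  apply: (mean_le coin_ge0) => s; do 2!apply: mean_le => // ?.
  apply: le_trans (fmaxD _ _ _); apply: fmax_le => j; apply: le_trans (le_fmax _ _ j) => /=.
  rewrite -big_split; apply: ler_sum => b _ /=.
  by rewrite ffunE /sgn; case: (s b); rewrite /= ?expr1 ?expr0; lra.
have -> : mean coin (fun s => mean p (fun f => mean p (fun f' => X s f' + X (neg s) f))) =
    2 * mean coin (fun s => mean p (fun f => X s f)).
  have -> : mean coin (fun s => mean p (fun f => mean p (fun f' => X s f' + X (neg s) f))) =
    mean coin (fun s => mean p (X s)) + mean coin (fun s => mean p (X (neg s))).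
    rewrite -meanD; apply: eq_mean => s.
    under eq_mean do rewrite meanD mean_cst //.
    by rewrite meanD mean_cst.
  have -> : mean coin (fun s => mean p (X (neg s))) = mean coin (fun s => mean p (X s)).
    rewrite [RHS](mean_reindex (phi := fun _ => negb)) // => _.
    exact: (inv_inj negbK).
  by rewrite mulr_natl mulr2n.
rewrite ler_pM2l // mean_exchange [X in _ <= X]mean_exchange.
by apply: mean_le => // f; apply: contraction.
Qed.

End Symmetrization.

(** * Heavy-tailed magnitudes *)

Section HeavyTail.
Variables (R : realType) (eps : R) (K : nat).
Hypotheses (eps_ge0 : 0 <= eps) (eps_le1 : eps <= 1).

(* The index k.+1 encodes the magnitude W = 2^k, and the index 0 encodes W = 0. *)
Definition tailW (i : 'I_K.+1) : R := if val i is k.+1 then 2 ^+ k else 0.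
Definition tailp (i : 'I_K.+1) : R :=
  if val i is k.+1 then eps / 2 ^+ k.+1 else 1 - eps * (1 - (2 ^+ K)^-1).

Definition signedp (t : bool * 'I_K.+1) : R := coin R t.1 * tailp t.2.

Lemma pow2_gt0 k : 0 < 2 ^+ k :> R. Proof. by rewrite exprn_gt0. Qed.

Lemma pow2_ge1 k : 1 <= 2 ^+ k :> R. Proof. by rewrite exprn_ege1 // ler1n. Qed.

Lemma tailp_ge0 i : 0 <= tailp i.
Proof.
rewrite /tailp; case: (val i) => [|k] /=; last by rewrite divr_ge0 // ltW ?pow2_gt0.
have v0 : 0 <= (2 ^+ K)^-1 :> R by rewrite invr_ge0 ltW ?pow2_gt0.
have h1 := eps_le1; have := mulr_ge0 eps_ge0 v0; move: (2 ^+ K)^-1 v0 => v v0 h; lra.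
Qed.

Lemma tail_sumE (F : R -> R) : \sum_i tailp i * F (tailW i) =
  tailp ord0 * F 0 + eps / 2 * \sum_(k < K) (2 ^+ k)^-1 * F (2 ^+ k).
Proof.
rewrite big_ord_recl; congr (_ + _); rewrite mulr_sumr; apply: eq_bigr => k _.
rewrite /tailp /tailW /= exprS invfM; ring.
Qed.

Lemma geom_half m : \sum_(k < m) (2 ^+ k)^-1 = 2 * (1 - (2 ^+ m)^-1) :> R.
Proof.
elim: m => [|m IH]; first by rewrite big_ord0 expr0 invr1 subrr mulr0.
by rewrite big_ord_recr /= IH exprS invfM; move: (2 ^+ m)^-1 => v; lra.
Qed.

Lemma tailp_sum1 : \sum_i tailp i = 1.
Proof.
have := tail_sumE (fun=> 1); under eq_bigr do rewrite mulr1.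
under [X in _ = _ + _ * X]eq_bigr do rewrite mulr1.
by rewrite geom_half /tailp /= => ->; move: (2 ^+ K)^-1 => v; lra.
Qed.

Lemma signedp_ge0 t : 0 <= signedp t.
Proof. by rewrite mulr_ge0 ?coin_ge0 ?tailp_ge0. Qed.

Lemma mean1_signedp (F : R -> R) : mean1 signedp (fun t => F (tailW t.2)) =
  tailp ord0 * F 0 + eps / 2 * \sum_(k < K) (2 ^+ k)^-1 * F (2 ^+ k).
Proof.
rewrite -tail_sumE /mean1 -(pair_big xpredT xpredT
  (fun b i => signedp (b, i) * F (tailW i))) /= big_bool -big_split /=.
by apply: eq_bigr => i _; rewrite /signedp /coin /=; lra.
Qed.

Lemma signedp_sum1 : \sum_t signedp t = 1.
Proof.
have := mean1_signedp (fun=> 1); rewrite /mean1.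
under eq_bigr do rewrite mulr1; move=> ->.
by rewrite -(tail_sumE (fun=> 1)); under eq_bigr do rewrite mulr1; rewrite tailp_sum1.
Qed.

Lemma tail_gt_le (w t : R) : 0 <= w -> 0 < t ->
  mean1 signedp (fun x => (t < tailW x.2 * w)%R%:R) <= eps * (w / t).
Proof.
move=> w0 t0; rewrite (mean1_signedp (fun W => (t < W * w)%R%:R)).
rewrite mul0r ltNge (ltW t0) mulr0 add0r -mulrA ler_wpM2l // mulrC ler_pdivrMr //.
pose S m : R := \sum_(k < m) (2 ^+ k)^-1 * (t < 2 ^+ k * w)%R%:R.
(* The term [2 * (2 ^+ K)^-1] is the rest of the geometric series from index [K] on; adding it makes
   the bound inductive. *)
have [H0 H1] : (2 ^+ K * w <= t -> S K = 0) /\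
   (t < 2 ^+ K * w -> S K + 2 * (2 ^+ K)^-1 <= 2 * (w / t)).
  elim: K => [|m [IH0 IH1]]; rewrite /S.
    rewrite big_ord0 expr0 mul1r; split => // h; rewrite invr1.
    by have : 1 <= w / t by [rewrite ler_pdivlMr // mul1r ltW]; lra.
  have w2 : 2 ^+ m * w <= 2 ^+ m.+1 * w by rewrite exprS; have := pow2_gt0 m; nra.
  rewrite big_ord_recr /= -/(S m); split => h.
    have h' := le_trans w2 h.
    by rewrite (IH0 h') ltNge h' mulr0 addr0.
  have [h'|h'] := ltP t (2 ^+ m * w).
    by rewrite exprS invfM mulr1; have := IH1 h'; move: (2 ^+ m)^-1 (w / t) (S m) => x y z; lra.
  rewrite IH0 // mulr0 !add0r ler_pM2l //.
  rewrite ler_pdivlMr // mulrC ler_pdivrMr ?pow2_gt0 // mulrC; exact: ltW.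
have wt : 0 <= w / t by apply: divr_ge0 => //; apply: ltW.
have [h|h] := ltP t (2 ^+ K * w).
  by have := H1 h; have := pow2_gt0 K; rewrite -invr_gt0 -/(S K); move: (2 ^+ K)^-1 (w / t) (S K) => x y z; lra.
by rewrite -/(S K) H0 //; lra.
Qed.

Lemma tail_sqr_le (w a : R) : 0 <= w -> 0 <= a ->
  mean1 signedp (fun x => tailW x.2 ^+ 2 * (tailW x.2 * w <= a)%R%:R) * w <= eps * a.
Proof.
move=> w0 a0; rewrite (mean1_signedp (fun W => W ^+ 2 * (W * w <= a)%R%:R)).
rewrite expr0n mul0r mulr0 add0r -!mulrA ler_wpM2l //.
pose S m : R := \sum_(k < m) (2 ^+ k)^-1 * ((2 ^+ k) ^+ 2 * (2 ^+ k * w <= a)%R%:R).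
(* The second bound serves the first: when [2 ^+ m * w <= a], both the new term [2 ^+ m] and the old
   sum, times [w], are at most [a]. *)
have H : forall m, S m * w <= 2 * a /\ S m <= 2 ^+ m.
  elim=> [|m [IH1 IH2]]; rewrite /S; first by rewrite big_ord0 mul0r expr0; split; lra.
  rewrite big_ord_recr /= -/(S m) expr2 -!mulrA mulKf ?gt_eqF ?pow2_gt0 // exprS.
  have p0 := pow2_gt0 m.
  have h3 := ler_wpM2r w0 IH2.
  have [h|h] := leP (2 ^+ m * w) a; rewrite ?mulr1 ?mulr0 ?addr0;
    by move: IH1 IH2 p0 h h3; move: (S m) (2 ^+ m) => s x *; split; lra.
by have [h _] := H K; rewrite -/(S K); move: (S K) h => s h; lra.
Qed.

(** The value [2 ^+ k] has probability [eps / 2 ^+ k.+1], so every scale adds the same [eps / 2] to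
    the mean of [W]: truncated means are counts of scales. *)
Let window m (w c : R) N : R := \sum_(k < m) (c < 2 ^+ k * w <= c * 2 ^+ N)%R%:R.

(** A half-open window of ratio 2 holds at most one scale. The first clause drives the induction:
    when the newest scale lands in the window, all earlier ones lie below it. *)
Lemma dyadic_window (w c : R) m : 0 < c -> 0 <= w ->
  [/\ 2 ^+ m * w <= c * 2 -> window m w c 1 = 0, window m w c 1 <= 1 &
      w <= c -> c * 2 < 2 ^+ m * w -> window m w c 1 = 1].
Proof.
move=> c0 w0; rewrite /window expr1.
elim: m => [|m [IHa IHb IHc]].
  by rewrite big_ord0 expr0 mul1r; split => // h1 h2; exfalso; lra.
rewrite big_ord_recr /=.
have e : 2 ^+ m.+1 * w = 2 * (2 ^+ m * w) by rewrite exprS mulrA.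
have p0 : 0 <= 2 ^+ m * w by rewrite mulr_ge0 // ltW ?pow2_gt0.
split.
- rewrite e => h; have h2 : 2 ^+ m * w <= c by lra.
  by rewrite IHa ?ltNge ?h2 ?add0r //; lra.
- have [h|h] := leP (2 ^+ m * w) (c * 2); last by rewrite andbF addr0.
  by rewrite (IHa h) add0r; case: (c < _).
- rewrite e => wc h; have h2 : c < 2 ^+ m * w by lra.
  have [h'|h'] := leP (2 ^+ m * w) (c * 2).
    by rewrite (IHa h') add0r andbT h2.
  by rewrite andbF addr0; apply: IHc.
Qed.

Lemma windowS m w c N : 0 < c ->
  window m w c N.+1 = window m w c N + window m w (c * 2 ^+ N) 1.
Proof.
move=> c0; rewrite /window -big_split /=; apply: eq_bigr => k _.
rewrite expr1 exprS (mulrC 2) mulrA; set z := 2 ^+ k * w; set d := c * 2 ^+ N.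
have d0 : 0 < d by rewrite mulr_gt0 ?pow2_gt0.
have cd : c <= d by rewrite ler_peMr ?pow2_ge1 // ltW.
case: (ltP c z) => h1; case: (leP z d) => h2 /=; rewrite ?add0r ?addr0 //.
- by have -> : z <= d * 2 by lra.
- by exfalso; lra.
Qed.

Lemma window_le m w c N : 0 < c -> 0 <= w -> window m w c N <= N%:R.
Proof.
move=> c0 w0; elim: N => [|N IH].
  by rewrite /window big1 // => k _; rewrite expr0 mulr1; case: ltP => // h; rewrite leNgt h.
rewrite windowS // -[N.+1%:R]natr1 lerD //.
have d0 : 0 < c * 2 ^+ N by rewrite mulr_gt0 ?pow2_gt0.
by have [] := dyadic_window m d0 w0.
Qed.

Lemma window_ge m w c N : 0 < c -> 0 <= w -> w <= c -> c * 2 ^+ N < 2 ^+ m * w ->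
  N%:R <= window m w c N.
Proof.
move=> c0 w0 wc; elim: N => [|N IH] h; first by apply: sumr_ge0.
have p0 := pow2_gt0 N.
have h' : c * 2 ^+ N * 2 < 2 ^+ m * w by move: h; rewrite exprS mulrA mulrAC.
have d0 : 0 < c * 2 ^+ N by rewrite mulr_gt0 ?pow2_gt0.
rewrite windowS // -[N.+1%:R]natr1 lerD ?IH //; first by lra.
have [_ _ -> //] := dyadic_window m d0 w0.
by apply: (le_trans wc); rewrite ler_peMr ?pow2_ge1 // ltW.
Qed.

Let tail_windowE (w c : R) N : 0 < c ->
  mean1 signedp (fun x => tailW x.2 * (c < tailW x.2 * w <= c * 2 ^+ N)%R%:R) =
  eps / 2 * window K w c N.
Proof.
move=> c0; rewrite (mean1_signedp (fun W => W * (c < W * w <= c * 2 ^+ N)%R%:R)).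
rewrite mul0r mulr0 add0r; congr (_ * _); apply: eq_bigr => k _.
by rewrite mulKf // gt_eqF ?pow2_gt0.
Qed.

Lemma tail_window_le (w c : R) N : 0 < c -> 0 <= w ->
  mean1 signedp (fun x => tailW x.2 * (c < tailW x.2 * w <= c * 2 ^+ N)%R%:R) <=
  eps / 2 * N%:R.
Proof.
by move=> c0 w0; rewrite tail_windowE // ler_wpM2l ?window_le // divr_ge0.
Qed.

Lemma tail_window_ge (w c : R) N : 0 < c -> 0 <= w -> w <= c ->
    c * 2 ^+ N < 2 ^+ K * w ->
  eps / 2 * N%:R <=
  mean1 signedp (fun x => tailW x.2 * (c < tailW x.2 * w <= c * 2 ^+ N)%R%:R).
Proof.
by move=> *; rewrite tail_windowE // ler_wpM2l ?window_ge // divr_ge0.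
Qed.

Lemma tail_neq0_le : mean1 signedp (fun x => (tailW x.2 != 0)%R%:R) <= eps.
Proof.
rewrite (mean1_signedp (fun W => (W != 0)%R%:R)) eqxx mulr0 add0r.
under eq_bigr => k _ do rewrite gt_eqF ?pow2_gt0 //= mulr1.
rewrite geom_half; have := pow2_gt0 K; rewrite -invr_gt0; move: (2 ^+ K)^-1 => v v0.
by have := mulr_ge0 eps_ge0 (ltW v0); lra.
Qed.

End HeavyTail.

(** * Collisions *)

Section Hashing.
Variables (R : realType) (r : nat).
Hypothesis r_gt0 : (0 < r)%N.

Definition unif (_ : 'I_r) : R := r%:R^-1.

Lemma unif_ge0 b : 0 <= unif b. Proof. by rewrite invr_ge0. Qed.

Lemma unif_sum1 : \sum_b unif b = 1.
Proof.
by rewrite sumr_const card_ord /unif -[_^-1 *+ _]mulr_natr mulVf // pnatr_eq0 -lt0n.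
Qed.

Lemma mean1_unif_eq a : mean1 unif (fun t => (t == a)%:R) = r%:R^-1.
Proof.
rewrite /mean1 (bigD1 a) //= eqxx mulr1 big1 ?addr0 // => t /negPf ->.
by rewrite mulr0.
Qed.

Variable I : finType.
Implicit Types h : {ffun I -> 'I_r}.

Let cen (p : I * I) h : R := (h p.1 == h p.2)%:R - r%:R^-1.

Lemma mean1_cen a : mean1 unif (fun t => (t == a)%:R - r%:R^-1) = 0.
Proof. by rewrite mean1D mean1_unif_eq (mean1_cst unif_sum1) subrr. Qed.

Let cov p q := mean unif (fun h => cen p h * cen q h).

(** The hash value of [p.1] occurs in no other place of the product, and averaging over it alone
    kills the centred indicator. *)
Lemma cov_fresh p q : p.1 != p.2 -> p.1 != q.1 -> p.1 != q.2 -> cov p q = 0.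
Proof.
case: p q => [i j] [k l] /= ij ik il.
rewrite /cov (mean_resample unif_sum1 i) -[RHS](mean_cst unif_sum1 I).
apply: eq_mean => h.
transitivity (mean1 unif (fun t => ((t == h j)%:R - r%:R^-1) * cen (k, l) h)).
  apply: eq_bigr => t _; rewrite /cen /= !ffunE eqxx.
  by rewrite [j == i]eq_sym [k == i]eq_sym [l == i]eq_sym !(negPf ij, negPf ik, negPf il).
by rewrite mean1Zr mean1_cen mul0r.
Qed.

Lemma cov_eq0 p q : p.1 != p.2 -> q != p -> q != (p.2, p.1) -> cov p q = 0.
Proof.
move=> p12 qp qsp.
have [h1|h1] := boolP ((p.1 == q.1) || (p.1 == q.2)); last first.
  by move: h1; rewrite negb_or => /andP[]; apply: cov_fresh.
have -> : cov p q = cov (p.2, p.1) q.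
  by apply: eq_mean => h; rewrite /cen /= eq_sym.
have [h2|h2] := boolP ((p.2 == q.1) || (p.2 == q.2)); last first.
  by move: h2; rewrite negb_or => /andP[a1 a2]; apply: cov_fresh; rewrite //= eq_sym.
move: p12 qp qsp; case/orP: h1 => /eqP E1; case/orP: h2 => /eqP E2.
- by rewrite E1 E2 eqxx.
- by rewrite [p]surjective_pairing E1 E2 -surjective_pairing eqxx.
- by rewrite E1 E2 -surjective_pairing eqxx.
- by rewrite E1 E2 eqxx.
Qed.

Lemma cov_le p : cov p p <= r%:R^-1 \/ p.1 = p.2.
Proof.
have [->|p12] := eqVneq p.1 p.2; [by right | left].
apply: (@le_trans _ _ (mean unif (fun h => (h p.1 == h p.2)%:R
   + (- (2 * r%:R^-1) * (h p.1 == h p.2)%:R + r%:R^-1 ^+ 2)))).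
  apply: (mean_le unif_ge0) => h; rewrite /cen.
  by case: (h p.1 == h p.2); rewrite /=; lra.
have Ec : mean unif (fun h => (h p.1 == h p.2)%:R) = r%:R^-1 :> R.
  rewrite (mean_resample unif_sum1 p.1) -[RHS](mean_cst unif_sum1 I).
  apply: eq_mean => h; rewrite -[RHS](mean1_unif_eq (h p.2)).
  by apply: eq_bigr => t _; rewrite !ffunE eqxx [p.2 == p.1]eq_sym (negPf p12).
rewrite !meanD meanZl mean_cst ?unif_sum1 // Ec.
by have : 0 <= r%:R^-1 ^+ 2 :> R by [apply: sqr_ge0]; lra.
Qed.

(* Collision indicators of distinct unordered pairs are uncorrelated. *)
Lemma collision_second_moment (c : I * I -> R) :
    (forall p, 0 <= c p) -> (forall p, p.1 = p.2 -> c p = 0) ->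
  mean unif (fun h => (\sum_p c p * ((h p.1 == h p.2)%:R - r%:R^-1)) ^+ 2) <=
  2 * (\sum_p c p ^+ 2) / r%:R.
Proof.
move=> c0 cd.
have -> : mean unif (fun h => (\sum_p c p * ((h p.1 == h p.2)%:R - r%:R^-1)) ^+ 2) =
    \sum_p \sum_q c p * c q * cov p q.
  transitivity (mean unif (fun h => \sum_p \sum_q c p * c q * (cen p h * cen q h))).
    apply: eq_mean => h; rewrite expr2 mulr_suml; apply: eq_bigr => p _.
    by rewrite mulr_sumr; apply: eq_bigr => q _; rewrite mulrACA.
  rewrite mean_sum; apply: eq_bigr => p _; rewrite mean_sum.
  by apply: eq_bigr => q _; rewrite meanZl.
pose sw (p : I * I) := (p.2, p.1).
have swK : involutive sw by case.
have E : \sum_p c (sw p) ^+ 2 = \sum_p c p ^+ 2.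
  by rewrite [RHS](reindex_inj (inv_inj swK)).
(* A pair correlates only with itself and its swap, and [x^2 + x y <= 3/2 x^2 + 1/2 y^2]; summed
   over ordered pairs this is the factor 2. *)
apply: (@le_trans _ _ (\sum_p (3 / 2 * c p ^+ 2 + 1 / 2 * c (sw p) ^+ 2) / r%:R)).
  apply: ler_sum => p _.
  have [pd|p12] := eqVneq p.1 p.2.
    rewrite big1 => [|q _]; last by rewrite (cd p pd) !mul0r.
    apply: divr_ge0 => //; have := sqr_ge0 (c p); have := sqr_ge0 (c (sw p)); lra.
  have sp : sw p != p.
    by case: p p12 => i j /= ij; rewrite xpair_eqE negb_and eq_sym ij.
  rewrite (bigD1 p) //= (bigD1 (sw p)) //= big1 ?addr0; last first.
    by move=> q /andP[qp qsp]; rewrite cov_eq0 ?mulr0.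
  have -> : cov p (sw p) = cov p p.
    by apply: eq_mean => h; rewrite /cen /= (eq_sym (h p.2)).
  have [le|/eqP] := cov_le p; last by rewrite (negPf p12).
  have := c0 p; have := c0 (sw p); move: (c p) (c (sw p)) => x y y0 x0.
  rewrite -mulrDl.
  apply: (@le_trans _ _ ((x * x + x * y) * r%:R^-1)).
    by apply: ler_wpM2l => //; rewrite addr_ge0 ?mulr_ge0.
  by apply: ler_wpM2r; [rewrite invr_ge0 | have := sqr_ge0 (x - y); lra].
rewrite -mulr_suml big_split /= -!mulr_sumr E.
by apply: ler_wpM2r; [rewrite invr_ge0 | lra].
Qed.

End Hashing.

(** * Collisions with heavier coordinates *)

Section Collisions.
Variables (R : realType) (n k r : nat) (V : ('I_n -> R) -> Prop) (S : R).
Variables (b : 'I_n -> 'rV[R]_k) (w : 'I_n -> R) (v : 'I_n -> 'I_n -> R).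
Hypothesis Hw : lewis_weights V S b w v.
Hypothesis r_gt0 : (0 < r)%N.
Variable theta : R.
Hypothesis theta_gt0 : 0 < theta.
Implicit Types (h : {ffun 'I_n -> 'I_r}) (y : 'I_n -> R).

Definition norm_1 y := \sum_j `|y j|.

Lemma norm_1_ge0 y : 0 <= norm_1 y. Proof. exact: sumr_ge0. Qed.

Lemma coord_le_norm_1 y j : V y -> `|y j| <= 4 * w j * norm_1 y.
Proof.
move=> /(lw_coord Hw)[x Ex Hx]; have w0 := lw_ge0 Hw j.
have w4 : 0 <= 4 * w j * norm_1 y by rewrite !mulr_ge0 ?norm_1_ge0.
rewrite -(ler_pXn2r (n:=2)) ?nnegrE // real_normK ?num_real // Ex.
apply: (le_trans (dot_sqr_le _ _)); rewrite (lw_norm Hw).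
have -> : (4 * w j * norm_1 y) ^+ 2 = w j ^+ 2 * (16 * norm_1 y ^+ 2) by ring.
by apply: ler_wpM2l => //; apply: sqr_ge0.
Qed.

Lemma S_ge0 : 0 <= S.
Proof. by apply: le_trans (lw_sum Hw); apply: sumr_ge0 => j _; apply: (lw_ge0 Hw). Qed.

(** Ties count in both directions, so that in a bucket every coordinate but one chosen heaviest
    collides. The bound [theta <= w j'] leaves at most [S / theta] candidates. *)
Definition heavier (j j' : 'I_n) := [&& j != j', w j <= w j' & theta <= w j'].

Definition ncoll h j : R := \sum_(j' | heavier j j') (h j == h j')%:R.

Definition hcount j : R := \sum_(j' | heavier j j') 1.

Lemma hcount_ge0 j : 0 <= hcount j. Proof. exact: sumr_ge0. Qed.

Lemma hcount_w_le j : hcount j * w j <= S.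
Proof.
rewrite /hcount mulr_suml; apply: le_trans (lw_sum Hw).
rewrite [X in _ <= X](bigID (heavier j)) /= -[X in X <= _]addr0.
apply: lerD; last by apply: sumr_ge0 => i _; apply: (lw_ge0 Hw).
by apply: ler_sum => i /and3P[_ h _]; rewrite mul1r.
Qed.

Lemma hcount_theta_le j : hcount j * theta <= S.
Proof.
rewrite /hcount mulr_suml; apply: le_trans (lw_sum Hw).
rewrite [X in _ <= X](bigID (heavier j)) /= -[X in X <= _]addr0.
apply: lerD; last by apply: sumr_ge0 => i _; apply: (lw_ge0 Hw).
by apply: ler_sum => i /and3P[_ _ h]; rewrite mul1r.
Qed.

Definition coll_dev i h : R := \sum_j `|v i j| * ncoll h j - \sum_j `|v i j| * (hcount j / r%:R).

Lemma ker_sqr_le i j c : 0 <= c -> c * w j <= S ->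
  v i j ^+ 2 * c <= v i j ^+ 2 / w j * S.
Proof.
move=> c0 cS; have [w0|w0] := eqVneq (w j) 0.
  have := lw_ker_le Hw i j; rewrite w0 mulr0 normr_le0 => /eqP ->.
  by rewrite expr0n !mul0r.
have wp : 0 < w j by rewrite lt_neqAle eq_sym w0 (lw_ge0 Hw).
rewrite -mulrA; apply: ler_wpM2l; first exact: sqr_ge0.
by rewrite mulrC ler_pdivlMr.
Qed.

(** The variance is governed by the sum of [v i j ^+ 2 * hcount j]; since at most [S / w j]
    coordinates are heavier than [j], the kernel bound [lw_ker_sum] applies. *)
Lemma collision_dev i : mean (unif R (r := r)) (fun h => coll_dev i h ^+ 2) <= 8 * S / r%:R.
Proof.
pose c (p : 'I_n * 'I_n) := if heavier p.1 p.2 then `|v i p.1| else 0.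
have -> : mean (unif R (r := r)) (fun h => coll_dev i h ^+ 2) =
   mean (unif R (r := r)) (fun h => (\sum_p c p * ((h p.1 == h p.2)%:R - r%:R^-1)) ^+ 2).
  apply: eq_mean => h; congr (_ ^+ 2).
  rewrite -(pair_big xpredT xpredT
    (fun j j' => c (j, j') * ((h j == h j')%:R - r%:R^-1))) /= /coll_dev -sumrB.
  apply: eq_bigr => j _; rewrite -mulrBr /ncoll /hcount mulr_suml -sumrB.
  rewrite mulr_sumr [RHS](bigID (heavier j)) /= [X in _ = _ + X]big1 ?addr0.
    by apply: eq_bigr => j' H; rewrite /c /= H mul1r.
  by move=> j' H; rewrite /c /= (negPf H) mul0r.
apply: (le_trans (collision_second_moment r_gt0 _ _)).
- by move=> p; rewrite /c; case: ifP.
- by move=> p p12; rewrite /c /heavier p12 eqxx.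
rewrite ler_pM2r ?invr_gt0 ?ltr0n //.
suff : \sum_p c p ^+ 2 <= 4 * S by lra.
have -> : \sum_p c p ^+ 2 = \sum_j v i j ^+ 2 * hcount j.
  rewrite -(pair_big xpredT xpredT (fun j j' => c (j, j') ^+ 2)) /=.
  apply: eq_bigr => j _; rewrite /hcount mulr_sumr.
  rewrite [LHS](bigID (heavier j)) /= [X in _ + X]big1 ?addr0.
    by apply: eq_bigr => j' H; rewrite /c /= H mulr1 real_normK ?num_real.
  by move=> j' H; rewrite /c /= (negPf H) expr0n.
apply: (@le_trans _ _ (\sum_j v i j ^+ 2 / w j * S)).
  by apply: ler_sum => j _; apply: ker_sqr_le; rewrite ?hcount_ge0 ?hcount_w_le.
rewrite -mulr_suml; apply: ler_wpM2r; [exact: S_ge0 | exact: (lw_ker_sum Hw)].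
Qed.

Lemma collision_mean i a : 0 < a ->
  \sum_j `|v i j| * (hcount j / r%:R) <= 2 * a + (S / (theta * r%:R)) ^+ 2 * S / (2 * a).
Proof.
move=> a0; set q := S / (theta * r%:R).
have r0 : 0 < r%:R :> R by rewrite ltr0n.
have pq j : hcount j / r%:R <= q.
  rewrite /q invfM mulrA ler_pM2r ?invr_gt0 // ler_pdivlMr //; exact: hcount_theta_le.
have p0 j : 0 <= hcount j / r%:R by rewrite divr_ge0 ?hcount_ge0.
(* AM-GM splits [|v i j| * q] into a part summable by [lw_ker_sum] and a part summable by [lw_sum];
   the free [a] balances them. *)
apply: (@le_trans _ _ (\sum_j (a / 2 * (v i j ^+ 2 / w j) + q ^+ 2 / (2 * a) * w j))).
  apply: ler_sum => j _; have [w0|w0] := eqVneq (w j) 0.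
    have := lw_ker_le Hw i j; rewrite w0 mulr0 normr_le0 => /eqP ->.
    by rewrite normr0 expr0n !mul0r !mulr0 addr0.
  have wp : 0 < w j by rewrite lt_neqAle eq_sym w0 (lw_ge0 Hw).
  apply: (@le_trans _ _ (`|v i j| * q)); first by apply: ler_wpM2l.
  rewrite -[v i j ^+ 2]real_normK ?num_real //; move: (`|v i j|) => x.
  rewrite -subr_ge0.
  have -> : a / 2 * (x ^+ 2 / w j) + q ^+ 2 / (2 * a) * w j - x * q =
     (a * x - q * w j) ^+ 2 / (2 * a * w j).
    by field; rewrite w0 (gt_eqF a0).
  by rewrite divr_ge0 ?sqr_ge0 // !mulr_ge0 // ltW.
rewrite big_split /= -!mulr_sumr; apply: lerD.
  by have := lw_ker_sum Hw i; have := a0; nra.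
rewrite -[X in _ <= X]mulrA [S / _]mulrC mulrA.
apply: ler_wpM2l; last exact: (lw_sum Hw).
by rewrite mulr_ge0 ?sqr_ge0 // invr_ge0 mulr_ge0 // ltW.
Qed.

(* The deviation Y = coll_dev satisfies |Y| <= t + Y^2 / t, and [coord_le_norm_1]
   bounds |y_i| by weights that add up to at most 4 S: a weighted union bound,
   with no dependence on n. *)
Lemma collision_uniform h y a t : V y -> 0 < a -> 0 < t ->
  \sum_j ncoll h j * `|y j| <=
  (2 * a + (S / (theta * r%:R)) ^+ 2 * S / (2 * a) + t
    + \sum_i 4 * w i * (coll_dev i h ^+ 2 / t)) * norm_1 y.
Proof.
move=> Vy a0 t0.
have nc0 j : 0 <= ncoll h j by apply: sumr_ge0.
set M := 2 * a + _.
apply: (@le_trans _ _ (\sum_i `|y i| * (M + t + coll_dev i h ^+ 2 / t))).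
  apply: (@le_trans _ _ (\sum_j ncoll h j * (\sum_i `|y i| * `|v i j|))).
    apply: ler_sum => j _; apply: ler_wpM2l => //; rewrite {1}(lw_repr Hw Vy).
    apply: (le_trans (ler_norm_sum _ _ _)).
    by apply: ler_sum => i _; rewrite normrM.
  under eq_bigr do rewrite mulr_sumr.
  rewrite exchange_big /=; apply: ler_sum => i _.
  under eq_bigr do rewrite mulrCA.
  rewrite -mulr_sumr; apply: ler_wpM2l => //.
  under eq_bigr do rewrite mulrC.
  have := @collision_mean i a a0; rewrite -/M => hM.
  have hY : coll_dev i h <= t + coll_dev i h ^+ 2 / t.
    move: (coll_dev i h) => x; rewrite -(ler_pM2r t0) mulrDl divfK ?gt_eqF //.
    by have := sqr_ge0 (x - t); have := sqr_ge0 (x + t); lra.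
  rewrite -addrA; have : \sum_j `|v i j| * ncoll h j =
     \sum_j `|v i j| * (hcount j / r%:R) + coll_dev i h by rewrite /coll_dev addrC subrK.
  by move=> ->; apply: lerD.
rewrite mulrDl.
under eq_bigr do rewrite mulrDr.
rewrite big_split /= -mulr_suml -/(norm_1 y) mulrC lerD2l mulr_suml.
apply: ler_sum => i _; rewrite [X in _ <= X]mulrAC; apply: ler_wpM2r; last exact: coord_le_norm_1.
by rewrite divr_ge0 ?sqr_ge0 // ltW.
Qed.

(* In a bucket containing heavy coordinates only the heaviest one survives for
   sure; every other coordinate j of that bucket has [ncoll h j >= 1]. *)
Lemma heavy_le h y :
  \sum_(j | theta <= w j) `|y j| <=
  \sum_(a < r) `|\sum_(j | h j == a) y j| + 2 * \sum_j ncoll h j * `|y j|.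
Proof.
have nc0 j : 0 <= ncoll h j by apply: sumr_ge0.
have -> : \sum_(j | theta <= w j) `|y j| =
    \sum_(a < r) \sum_(j | (theta <= w j) && (h j == a)) `|y j|.
  by rewrite (partition_big h xpredT).
have -> : \sum_j ncoll h j * `|y j| =
    \sum_(a < r) \sum_(j | h j == a) ncoll h j * `|y j|.
  by rewrite (partition_big h xpredT).
rewrite mulr_sumr -big_split /=; apply: ler_sum => a _.
have [[t0 /andP[Ht0 Ha0]]|none] := pselect (exists t, (theta <= w t) && (h t == a));
    last first.
  rewrite big_pred0 ?addr_ge0 ?mulr_ge0 ?sumr_ge0 // => [j _|j].
    by rewrite mulr_ge0.
  by apply/negP => Hj; apply: none; exists j.
have Pt0 : h t0 == a by [].
have [t ht tmax] : exists2 t, h t == a & forall j, h j == a -> w j <= w t.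
  by case: (@arg_maxP _ _ _ t0 (fun t => h t == a) w Pt0) => t; exists t.
have thw : theta <= w t by apply: (le_trans Ht0); apply: tmax.
have nc1 j : h j == a -> j != t -> 1 <= ncoll h j.
  move=> hj jt; rewrite /ncoll (bigD1 t) /=; last first.
    by rewrite /heavier jt thw tmax.
  by rewrite (eqP hj) (eqP ht) eqxx lerDl sumr_ge0.
have Hrest : \sum_(j | (h j == a) && (j != t)) `|y j| <=
    \sum_(j | h j == a) ncoll h j * `|y j|.
  rewrite [X in _ <= X](bigD1 t) //= -[X in X <= _]add0r; apply: lerD.
    by rewrite mulr_ge0.
  by apply: ler_sum => j /andP[hj jt]; rewrite -[X in X <= _]mul1r ler_wpM2r ?nc1.
(* The rest of the bucket is paid for twice: once for itself, once for what it may cancel of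
   [y t]. *)
apply: (@le_trans _ _ (`|y t| + \sum_(j | (h j == a) && (j != t)) `|y j|)).
  rewrite (bigD1 t) ?thw ?ht //= lerD2l.
  rewrite [X in _ <= X](bigID (fun j => theta <= w j)) /= -[X in X <= _]addr0.
  apply: lerD; last by apply: sumr_ge0.
  rewrite le_eqVlt; apply/orP; left; apply/eqP; apply: eq_bigl => j.
  by rewrite -andbA andbC.
have : `|y t| <= `|\sum_(j | h j == a) y j| + \sum_(j | (h j == a) && (j != t)) `|y j|.
  have -> : \sum_(j | h j == a) y j = y t + \sum_(j | (h j == a) && (j != t)) y j.
    by rewrite (bigD1 t).
  set z := \sum_(j | _) y j; have hz : `|z| <= \sum_(j | (h j == a) && (j != t)) `|y j|.
    exact: ler_norm_sum.
  have -> : `|y t| = `|(y t + z) - z| by rewrite addrK.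
  by apply: (le_trans (ler_normB _ _)); rewrite lerD2l.
by move: Hrest; lra.
Qed.

End Collisions.

(** * Elementary exponential inequalities *)

Section ExpBounds.
Variable R : realType.
Implicit Type x : R.

(** From [exp (- x) >= 1 - x] comes [exp x <= 1 / (1 - x)], and the right side times [1 - x] is
    [1 + x^2 (1 - 2 x) >= 1]. *)
Lemma expR_le_quad x : x <= 1 / 2 -> expR x <= 1 + x + 2 * x ^+ 2.
Proof.
move=> x2; have h := expR_ge1Dx (- x).
have e : expR x * expR (- x) = 1 by rewrite -expRD subrr expR0.
have p := expR_gt0 x.
have h1 : expR x * (1 - x) <= 1 by rewrite -[X in _ <= X]e ler_pM2l.
rewrite -(ler_pM2r (x := 1 - x)); last by lra.
apply: (le_trans h1).
have -> : (1 + x + 2 * x ^+ 2) * (1 - x) = 1 + x ^+ 2 * (1 - 2 * x) by ring.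
by rewrite lerDl mulr_ge0 ?sqr_ge0 //; lra.
Qed.

Lemma expR_ge_pow x q : (0 < q)%N -> 0 <= x -> (x / q%:R) ^+ q <= expR x.
Proof.
move=> q0 x0; have q1 : q%:R != 0 :> R by rewrite pnatr_eq0 -lt0n.
have {2}-> : x = \sum_(i < q) (x / q%:R).
  by rewrite sumr_const card_ord -[_ *+ q]mulr_natr divfK.
rewrite expR_sum -[X in _ ^+ X](card_ord q) -prodr_const.
have y0 : 0 <= x / q%:R by rewrite divr_ge0.
by apply: ler_prod => i _; rewrite y0 /=; have := expR_ge1Dx (x / q%:R); lra.
Qed.

Lemma prod_le_expR (I : finType) (F G : I -> R) :
    (forall i, 0 <= F i) -> (forall i, F i <= 1 + G i) ->
  \prod_i F i <= expR (\sum_i G i).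
Proof.
move=> F0 FG; rewrite expR_sum; apply: ler_prod => i _.
by rewrite F0 (le_trans (FG i)) // expR_ge1Dx.
Qed.

End ExpBounds.

(** * Bucket loads *)

Section Load.
Variables (R : realType) (n r : nat) (S : R) (w : 'I_n -> R).
Hypotheses (w_ge0 : forall j, 0 <= w j) (w_sum : \sum_j w j <= S) (r_gt0 : (0 < r)%N).
Variables (theta s l : R).
Hypotheses (s_ge0 : 0 <= s) (s_le : s * theta <= 1 / 2).

Definition load (h : {ffun 'I_n -> 'I_r}) a : R :=
  \sum_(j | (h j == a) && (w j < theta)) w j.

(** Chernoff: the moment factorizes over coordinates, and [s * w j <= 1/2] for a light [j] bounds
    its factor by [1 + 2 s w_j / r]. *)
Lemma load_exp_moment a :
  mean (unif R (r := r)) (fun h => expR (s * load h a)) <= expR (2 * s * S / r%:R).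
Proof.
pose phi j (t : 'I_r) := if (t == a) && (w j < theta) then expR (s * w j) else 1.
have -> : mean (unif R (r := r)) (fun h => expR (s * load h a)) =
    mean (unif R (r := r)) (fun h : {ffun 'I_n -> 'I_r} => \prod_j phi j (h j)).
  apply: eq_mean => h; rewrite /load mulr_sumr big_mkcond /= expR_sum.
  by apply: eq_bigr => j _; rewrite /phi; case: ifP; rewrite ?expR0.
have phi0 j t : 0 <= phi j t by rewrite /phi; case: ifP => _ //; apply: expR_ge0.
rewrite mean_prod; apply: (@le_trans _ _ (expR (\sum_j 2 * s * w j / r%:R))).
  apply: prod_le_expR => j.
    by apply: mean1_ge0 => // t; apply: unif_ge0.
  have sw : 0 <= 2 * s * w j by rewrite !mulr_ge0.
  apply: (@le_trans _ _ (mean1 (unif R (r := r)) (fun t => 1 + 2 * s * w j * (t == a)%:R))).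
    apply: mean1_le => [t|t]; first exact: unif_ge0.
    rewrite /phi; case: (t == a) => /=; last by rewrite mulr0 addr0.
    case: ltP => wj; last by rewrite mulr1; lra.
    have s0 := s_ge0; have s1 := s_le; have w0 := w_ge0 j.
    have h1 : s * w j <= 1 / 2.
      by apply: le_trans s1; apply: ler_wpM2l => //; apply: ltW.
    apply: (le_trans (expR_le_quad h1)).
    have h0 : 0 <= s * w j by rewrite mulr_ge0.
    rewrite mulr1 -mulrA; move: (s * w j) h0 h1 => x h0 h1; nra.
  rewrite mean1D mean1Zl mean1_unif_eq mean1_cst //.
  exact: unif_sum1.
rewrite ler_expR; have -> : \sum_j 2 * s * w j / r%:R = 2 * s / r%:R * \sum_j w j.
  by rewrite mulr_sumr; apply: eq_bigr => j _; rewrite mulrAC.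
rewrite [X in _ <= X]mulrAC; apply: ler_wpM2l => //.
by rewrite divr_ge0 ?mulr_ge0.
Qed.

Lemma overload_mean :
  mean (unif R (r := r)) (fun h => \sum_a (l < load h a)%R%:R) <=
  r%:R * expR (2 * s * S / r%:R - s * l).
Proof.
rewrite mean_sum; apply: (@le_trans _ _ (\sum_(a < r) expR (2 * s * S / r%:R - s * l))).
  apply: ler_sum => a _; rewrite expRD.
  apply: (@le_trans _ _ (mean (unif R (r := r)) (fun h => expR (s * load h a) * expR (- (s * l))))).
    apply: mean_le => [t|h]; first exact: unif_ge0.
    rewrite -expRD; case: ltP => hl /=; last exact: expR_ge0.
    apply: (@le_trans _ _ (expR 0)); first by rewrite expR0.
    by rewrite ler_expR subr_ge0; apply: ler_wpM2l => //; apply: ltW.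
  by rewrite meanZr; apply: ler_wpM2r; [apply: expR_ge0 | apply: load_exp_moment].
by rewrite sumr_const card_ord -[_ *+ r]mulr_natl.
Qed.

End Load.

(** * The heavy-tailed block *)

Section HeavyTailedSketch.
Variables (R : realType) (n k r K : nat) (V : ('I_n -> R) -> Prop) (S : R).
Variables (b : 'I_n -> 'rV[R]_k) (w : 'I_n -> R) (v : 'I_n -> 'I_n -> R).
Hypothesis Hw : lewis_weights V S b w v.
Variable eps : R.
Hypotheses (eps_ge0 : 0 <= eps) (eps_le1 : eps <= 1).
Variable h : {ffun 'I_n -> 'I_r}.

Local Notation T := (bool * 'I_K.+1)%type.
Local Notation p := (signedp eps (K := K)).
Implicit Types (f : {ffun 'I_n -> T}) (y : 'I_n -> R) (a : 'I_r).

Let p_ge0 t : 0 <= p t. Proof. exact: signedp_ge0. Qed.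
Let p_sum1 : \sum_t p t = 1. Proof. exact: signedp_sum1. Qed.

Definition mag f j : R := tailW R (f j).2.
Definition coef f j : R := sgn R (f j).1 * mag f j.
Definition bucket y a f : R := \sum_(j | h j == a) coef f j * y j.

Lemma sum_buckets (F : 'I_n -> R) : \sum_a \sum_(j | h j == a) F j = \sum_j F j.
Proof. by rewrite [RHS](partition_big h xpredT). Qed.

Lemma tailW_ge0 (i : 'I_K.+1) : 0 <= tailW R i.
Proof. by rewrite /tailW; case: (val i) => // m; apply: exprn_ge0. Qed.

Lemma mag_ge0 f j : 0 <= mag f j. Proof. exact: tailW_ge0. Qed.

Lemma sgn_norm c : `|sgn R c| = 1.
Proof. by rewrite /sgn normrX normrN1 expr1n. Qed.

Lemma sgn_sqr c : sgn R c ^+ 2 = 1.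
Proof. by rewrite /sgn sqrr_sign. Qed.

Lemma coef_norm f j : `|coef f j| = mag f j.
Proof. by rewrite /coef normrM sgn_norm mul1r ger0_norm ?mag_ge0. Qed.

Definition resign (rho : {ffun 'I_n -> bool}) f : {ffun 'I_n -> T} :=
  [ffun j => (rho j (+) (f j).1, (f j).2)].

Lemma mean_resign rho F : mean p F = mean p (fun f => F (resign rho f)).
Proof.
rewrite (mean_reindex (phi := fun j t => (rho j (+) t.1, t.2))) //.
by move=> j [c1 i1] [c2 i2] /= [/addbI -> ->].
Qed.

Lemma mag_resign rho f j : mag (resign rho f) j = mag f j.
Proof. by rewrite /mag ffunE. Qed.

Lemma coef_resign rho f j : coef (resign rho f) j = sgn R (rho j) * coef f j.
Proof. by rewrite /coef mag_resign ffunE /= /sgn signr_addb mulrA. Qed.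

Section MainTerm.
Variables (u0 : R) (N : nat).
Hypothesis u0_gt0 : 0 < u0.
Let u1 := u0 * 2 ^+ N.

Let u0_le_u1 : u0 <= u1.
Proof. by rewrite ler_peMr ?pow2_ge1 // ltW. Qed.

(** Truncation for the lower bound: zeroing a bucket only shortens the sketch and leaves jumps of
    size at most [u1]. The condition ignores signs, so sign flips preserve it. *)
Definition nobig a f := [forall j, (h j == a) ==> (mag f j * w j <= u1)].
Definition tbucket y a f : R := (nobig a f)%:R * bucket y a f.

(** [j] is the only coordinate of its bucket above [u0]. A bucket thus has at most one such [j], and
    the truncation spares it. *)
Let win j f := (u0 < mag f j * w j <= u1) &&
  [forall i, ((i != j) && (h i == h j)) ==> (mag f i * w i <= u0)].

Lemma win_nobig j f : win j f -> nobig (h j) f.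
Proof.
move=> /andP[/andP[_ h1] /forallP H]; apply/forallP => i; apply/implyP => hi.
have [->//|ij] := eqVneq i j.
by apply: le_trans u0_le_u1; have := H i; rewrite ij hi.
Qed.

Lemma win_uniq i j f : h i = h j -> win i f -> win j f -> i = j.
Proof.
move=> hij /andP[/andP[h1 _] _] /andP[_ /forallP H].
have [//|ij] := eqVneq i j.
by have := H i; rewrite ij hij eqxx /= leNgt h1.
Qed.

Lemma tbucket_ge_win y a f :
  \sum_(j | h j == a) (win j f)%:R * `|bucket y (h j) f| <= `|tbucket y a f|.
Proof.
have [[j /andP[/eqP hj wj]]|none] := pselect (exists j, (h j == a) && win j f); last first.
  rewrite big1 // => j hj; have -> : win j f = false; last by rewrite mul0r.
  by apply/negP => wj; apply: none; exists j; rewrite hj.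
rewrite (bigD1 j) ?hj //= big1 ?addr0 => [|i /andP[/eqP hi ij]]; last first.
  have -> : win i f = false; last by rewrite mul0r.
  by apply/negP => wi; move: ij; rewrite (win_uniq _ wi wj) ?eqxx // hi.
by rewrite wj /tbucket -hj (win_nobig wj) !mul1r.
Qed.

(** Flipping the sign of [j] alone preserves the law and [win]. The two bucket values [c + z] and
    [- c + z] differ by [2 c], so their absolute values average at least [|c|]. *)
Lemma win_bucket_mean y j :
  mean p (fun f => (win j f)%:R * (mag f j * `|y j|)) <=
  mean p (fun f => (win j f)%:R * `|bucket y (h j) f|).
Proof.
pose rho : {ffun 'I_n -> bool} := [ffun i => i == j].
have win_rho f : win j (resign rho f) = win j f.
  rewrite /win mag_resign; congr (_ && _); apply: eq_forallb => i.
  by rewrite mag_resign.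
rewrite -(ler_pM2l (x := 2)) // [X in _ <= X]mulr_natl mulr2n.
rewrite [X in _ <= _ + X](mean_resign rho) -meanD -meanZl.
apply: mean_le => // f; rewrite win_rho -mulrDr mulrCA; apply: ler_wpM2l => //.
pose z := \sum_(i | (h i == h j) && (i != j)) coef f i * y i.
have E1 : bucket y (h j) f = coef f j * y j + z by rewrite /bucket (bigD1 j).
have E2 : bucket y (h j) (resign rho f) = - (coef f j * y j) + z.
  rewrite /bucket (bigD1 j) //= coef_resign ffunE eqxx /sgn expr1 mulN1r mulNr.
  congr (_ + _); apply: eq_bigr => i /andP[_ /negPf ij].
  by rewrite coef_resign ffunE ij /sgn expr0 mul1r.
rewrite E1 E2 -coef_norm -normrM; move: (coef f j * y j) => c.
have -> : 2 * `|c| = `|(c + z) - (- c + z)|.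
  have -> : c + z - (- c + z) = 2 * c by ring.
  by rewrite normrM ger0_norm.
exact: ler_normB.
Qed.

Lemma win_mean_ge j : 0 <= w j -> w j <= u0 -> u1 < 2 ^+ K * w j ->
    \sum_(i | (i != j) && (h i == h j)) w i <= u0 / 2 ->
  eps / 4 * N%:R <= mean p (fun f => (win j f)%:R * mag f j).
Proof.
move=> w0 wu uw others.
pose A (t : T) : R := tailW R t.2 * (u0 < tailW R t.2 * w j <= u1)%R%:R.
pose Q i (t : T) : R := (u0 < tailW R t.2 * w i)%R%:R.
have A0 t : 0 <= A t by rewrite mulr_ge0 ?tailW_ge0.
have mA : eps / 2 * N%:R <= mean1 p A by apply: tail_window_ge.
have mQ i : mean1 p (Q i) <= eps * (w i / u0).
  by apply: tail_gt_le => //; apply: (lw_ge0 Hw).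
have mA0 : 0 <= mean1 p A by apply: mean1_ge0.
(* Union bound: the indicator of [win] is at least that of the window times 1 minus the sum of the
   [Q i]. Independence of distinct coordinates and the bound [u0 / 2] on the other weights lose only
   a factor 2. *)
apply: (@le_trans _ _ (mean p (fun f => A (f j)
    + \sum_(i | (i != j) && (h i == h j)) A (f j) * (-1 * Q i (f i))))); last first.
  apply: mean_le => // f; rewrite -mulr_sumr -[X in X + _]mulr1 -mulrDr -mulr_sumr mulN1r.
  have m0 := mag_ge0 f j.
  have Q0 i : 0 <= Q i (f i) by [].
  have s0 : 0 <= \sum_(i | (i != j) && (h i == h j)) Q i (f i) by apply: sumr_ge0.
  rewrite /A -/(mag f j) /win.
  case: (boolP (u0 < mag f j * w j <= u1)) => _; last by rewrite mulr0 !mul0r.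
  rewrite mulr1 andTb; case: (boolP [forall i, _]) => [_|].
    by rewrite mul1r ler_piMr // lerBlDr lerDl.
  rewrite negb_forall => /existsP[i]; rewrite negb_imply -ltNge => /andP[Hi Qi].
  rewrite mul0r mulr_ge0_le0 // subr_le0 (bigD1 i) //= {1}/Q -/(mag f i) Qi.
  by rewrite lerDl; apply: sumr_ge0.
rewrite meanD mean_sum mean_coord //.
under eq_bigr => i /andP[ij _].
  rewrite (mean_coord2 p_sum1 A (fun t => -1 * Q i t)) 1?eq_sym // mean1Zl.
  over.
rewrite -mulr_sumr -mulr_sumr mulN1r.
have : \sum_(i | (i != j) && (h i == h j)) mean1 p (Q i) <= 1 / 2.
  apply: (@le_trans _ _ (\sum_(i | (i != j) && (h i == h j)) w i / u0)).
    apply: ler_sum => i _; apply: (le_trans (mQ i)); rewrite ler_piMl //.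
    by rewrite divr_ge0 ?(lw_ge0 Hw) // ltW.
  rewrite -mulr_suml ler_pdivrMr // mul1r mulrC.
  exact: others.
move=> /(ler_wpM2l mA0); rewrite mulrN; lra.
Qed.

Lemma tbucket_mean_ge (P : pred 'I_n) y :
    (forall j, P j -> [/\ w j <= u0, u1 < 2 ^+ K * w j &
      \sum_(i | (i != j) && (h i == h j)) w i <= u0 / 2]) ->
  eps / 4 * N%:R * \sum_(j | P j) `|y j| <= \sum_a mean p (fun f => `|tbucket y a f|).
Proof.
move=> HP; apply: (@le_trans _ _ (\sum_a \sum_(j | h j == a)
    mean p (fun f => (win j f)%:R * `|bucket y (h j) f|))); last first.
  apply: ler_sum => a _; rewrite -mean_sum; apply: mean_le => // f.
  exact: tbucket_ge_win.
rewrite sum_buckets mulr_sumr big_mkcond /=.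
apply: ler_sum => j _; case: ifP => [Pj|_]; last first.
  by apply: mean_ge0 => // f; rewrite mulr_ge0.
have [h1 h2 h3] := HP j Pj; apply: le_trans (win_bucket_mean y j).
under eq_mean do rewrite mulrA.
rewrite meanZr; apply: ler_wpM2r => //; apply: win_mean_ge => //.
exact: (lw_ge0 Hw).
Qed.

(** Summands of the overview's [G_i], with the bucket signs of the symmetrization and the truncation
    included. *)
Let drift i (s : {ffun 'I_r -> bool}) f j : R :=
  sgn R (s (h j)) * coef f j * (nobig (h j) f)%:R * v i j.

(** The truncation makes the summands dependent, so fresh signs [rho] are inserted first: given [f],
    the summands are independent, symmetric and at most [4 u1]. Afterwards the bucket's truncation
    is relaxed to that of [j] alone, as in [D], and the bound factorizes over [f]. *)
Lemma drift_exp_moment i s c : `|c| * (4 * u1) <= 1 / 2 ->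
  mean p (fun f => expR (c * \sum_j drift i s f j)) <= expR (8 * c ^+ 2 * (eps * u1)).
Proof.
move=> hc.
have drift_resign rho f j : drift i s (resign rho f) j = sgn R (rho j) * drift i s f j.
  rewrite /drift coef_resign; have -> : nobig (h j) (resign rho f) = nobig (h j) f.
    by apply: eq_forallb => l; rewrite mag_resign.
  by rewrite !mulrA [sgn R (rho j) * _]mulrC.
pose D j (t : T) := tailW R t.2 ^+ 2 * (tailW R t.2 * w j <= u1)%R%:R.
have drift_sqr f j : drift i s f j ^+ 2 <= v i j ^+ 2 * D j (f j).
  have cs : coef f j ^+ 2 = mag f j ^+ 2 by rewrite /coef exprMn sgn_sqr mul1r.
  have -> : drift i s f j ^+ 2 =
      v i j ^+ 2 * (coef f j ^+ 2 * (nobig (h j) f)%:R ^+ 2) * sgn R (s (h j)) ^+ 2.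
    by rewrite /drift; ring.
  rewrite sgn_sqr mulr1 cs.
  apply: ler_wpM2l; first exact: sqr_ge0.
  apply: ler_wpM2l; first exact: sqr_ge0.
  case: (boolP (nobig (h j) f)) => [/forallP/(_ j)|_].
    by rewrite eqxx /= => ->; rewrite expr1n.
  by rewrite expr0n.
have u1_ge0 : 0 <= u1 by apply: le_trans u0_le_u1; apply: ltW.
have drift_abs f j : `|drift i s f j| <= 4 * u1.
  rewrite /drift 3!normrM sgn_norm mul1r coef_norm.
  have m0 := mag_ge0 f j; have lv := lw_ker_le Hw i j.
  case: (boolP (nobig (h j) f)) => [/forallP/(_ j)|_]; last first.
    by rewrite normr0 mulr0 mul0r mulr_ge0.
  rewrite eqxx /= normr1 mulr1 => hm.
  apply: (@le_trans _ _ (mag f j * (4 * w j))); first exact: ler_wpM2l.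
  by rewrite mulrCA; apply: ler_wpM2l.
have -> : mean p (fun f => expR (c * \sum_j drift i s f j)) =
   mean p (fun f => mean (coin R) (fun rho : {ffun 'I_n -> bool} =>
     \prod_j expR (c * (sgn R (rho j) * drift i s f j)))).
  rewrite -[LHS](mean_cst (coin_sum1 R) 'I_n) [RHS]mean_exchange; apply: eq_mean => rho.
  rewrite (mean_resign rho); apply: eq_mean => f.
  rewrite mulr_sumr expR_sum; apply: eq_bigr => j _.
  by rewrite drift_resign.
apply: (@le_trans _ _ (mean p (fun f => \prod_j (1 + 2 * c ^+ 2 * (v i j ^+ 2 * D j (f j)))))).
  apply: mean_le => // f.
  rewrite (mean_prod (coin R) (fun j t => expR (c * (sgn R t * drift i s f j)))).
  apply: ler_prod => j _; rewrite mean1_coin.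
  rewrite divr_ge0 ?addr_ge0 ?expR_ge0 //= /sgn expr1 expr0 mulN1r mul1r mulrN.
  have hd : `|c * drift i s f j| <= 1 / 2.
    by rewrite normrM; apply: le_trans hc; apply: ler_wpM2l.
  have hs := drift_sqr f j.
  have hs' : (c * drift i s f j) ^+ 2 <= c ^+ 2 * (v i j ^+ 2 * D j (f j)).
    by rewrite exprMn; apply: ler_wpM2l => //; apply: sqr_ge0.
  move: hs' hd; rewrite -[2 * _ * _]mulrA.
  move: (c * drift i s f j) (c ^+ 2 * (v i j ^+ 2 * D j (f j))) => x z hz.
  rewrite ler_norml => /andP[hx1 hx2].
  have e1 := expR_le_quad hx2; have e2 : - x <= 1 / 2 by lra.
  by have := expR_le_quad e2; rewrite sqrrN; lra.
rewrite (mean_prod p (fun j t => 1 + 2 * c ^+ 2 * (v i j ^+ 2 * D j t))).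
have c2 : 0 <= 2 * c ^+ 2 by rewrite mulr_ge0 ?sqr_ge0.
have D0 j t : 0 <= D j t by rewrite mulr_ge0 ?sqr_ge0.
have vD0 j t : 0 <= 2 * c ^+ 2 * (v i j ^+ 2 * D j t).
  by rewrite mulr_ge0 // mulr_ge0 ?sqr_ge0.
apply: (@le_trans _ _ (expR (\sum_j 2 * c ^+ 2 * (v i j ^+ 2 / w j * (eps * u1))))).
  apply: prod_le_expR => j.
    by apply: mean1_ge0 => // t; rewrite addr_ge0.
  rewrite mean1D mean1_cst // lerD2l mean1Zl; apply: ler_wpM2l => //.
  rewrite mean1Zl; have := @tail_sqr_le R eps K eps_ge0 (w j) u1 (lw_ge0 Hw j) u1_ge0.
  rewrite -/(mean1 p (D j)); have [w0|w0] := eqVneq (w j) 0.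
    have := lw_ker_le Hw i j; rewrite w0 mulr0 normr_le0 => /eqP ->.
    by rewrite expr0n !mul0r.
  have wp : 0 < w j by rewrite lt_neqAle eq_sym w0 (lw_ge0 Hw).
  move=> hD; rewrite -mulrA; apply: ler_wpM2l; first exact: sqr_ge0.
  by rewrite mulrC ler_pdivlMr.
rewrite ler_expR -mulr_sumr -mulr_suml.
have := lw_ker_sum Hw i; move: (\sum_j _ / w j) => z hz.
have e0 : 0 <= eps * u1 by rewrite mulr_ge0.
have h4 := ler_wpM2r e0 hz; have := ler_wpM2l c2 h4; lra.
Qed.

Lemma drift_pow_moment i s q lam : 0 < lam -> lam * (4 * u1) <= 1 / 2 ->
  mean p (fun f => `|\sum_j drift i s f j| ^+ q.+1) <=
  2 * (q.+1%:R / lam) ^+ q.+1 * expR (8 * lam ^+ 2 * (eps * u1)).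
Proof.
move=> l0 hl.
apply: (@le_trans _ _ (mean p (fun f => (q.+1%:R / lam) ^+ q.+1 *
   (expR (lam * \sum_j drift i s f j) + expR (- lam * \sum_j drift i s f j))))).
  apply: mean_le => // f; move: (\sum_j _) => z.
  have c0 : 0 <= (q.+1%:R / lam) ^+ q.+1 by rewrite exprn_ge0 // divr_ge0 // ltW.
  have e : `|z| ^+ q.+1 = (q.+1%:R / lam) ^+ q.+1 * (lam * `|z| / q.+1%:R) ^+ q.+1.
    rewrite -exprMn; congr (_ ^+ _).
    have : q.+1%:R != 0 :> R by rewrite pnatr_eq0.
    by move: (q.+1%:R) => Q Q0; field; rewrite Q0 gt_eqF.
  rewrite e; apply: ler_wpM2l => //.
  have lz : 0 <= lam * `|z| by rewrite mulr_ge0 // ltW.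
  apply: (le_trans (expR_ge_pow (ltn0Sn q) lz)).
  have [z0|z0] := leP 0 z; first by rewrite (ger0_norm z0) lerDl expR_ge0.
  by rewrite (ltr0_norm z0) mulrN -mulNr lerDr expR_ge0.
rewrite meanZl meanD; set c := (_ / lam) ^+ q.+1.
have c0 : 0 <= c by rewrite exprn_ge0 // divr_ge0 // ltW.
rewrite [2 * c]mulrC -[X in _ <= X]mulrA; apply: ler_wpM2l => //.
have hl1 : `|lam| * (4 * u1) <= 1 / 2 by rewrite gtr0_norm.
have hl2 : `|- lam| * (4 * u1) <= 1 / 2 by rewrite normrN.
have := drift_exp_moment i s hl1; have := drift_exp_moment i s hl2.
by rewrite sqrrN; lra.
Qed.

Lemma le_add_pow (x t : R) q : 0 <= x -> 0 < t -> x <= t + x ^+ q.+1 / t ^+ q.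
Proof.
move=> x0 t0; have tq : 0 < t ^+ q by rewrite exprn_gt0.
have [xt|tx] := leP x t.
  by apply: (le_trans xt); rewrite lerDl divr_ge0 ?exprn_ge0 // ltW.
rewrite -[X in X <= _]add0r; apply: lerD; first exact: ltW.
rewrite ler_pdivlMr // exprS; apply: ler_wpM2l => //.
by apply: lerXn2r; rewrite ?nnegrE // ltW.
Qed.

(** What exceeds [t] is paid for by the moment of order [q + 1]. Summing these moments with weights
    [4 * w i] loses a factor [4 * S]; the free order [q] is there to beat it. *)
Lemma tbucket_deviation (J : finType) (j0 : J) (yy : J -> 'I_n -> R) q lam t :
    (forall j, V (yy j)) -> (forall j, norm_1 (yy j) <= 1) ->
    0 < lam -> lam * (4 * u1) <= 1 / 2 -> 0 < t ->
  mean p (fun f => fmax j0 (fun j =>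
    \sum_a (mean p (fun f' => `|tbucket (yy j) a f'|) - `|tbucket (yy j) a f|))) <=
  2 * (t + 8 * S * ((q.+1%:R / lam) ^+ q.+1 * expR (8 * lam ^+ 2 * (eps * u1))) / t ^+ q).
Proof.
move=> Vy y1 l0 hl t0.
apply: (@le_trans _ _ (2 * mean (coin R) (fun s => mean p (fun f =>
    fmax j0 (fun j => \sum_a sgn R (s a) * tbucket (yy j) a f))))).
  apply: (symmetrization j0 p_ge0 p_sum1 (h := h)) => j a f f' ff'.
  have cf i : h i == a -> coef f i = coef f' i.
    by move=> /eqP /ff' E; rewrite /coef /mag E.
  rewrite /tbucket; congr (_ * _).
    congr (_ %:R); congr nat_of_bool; apply: eq_forallb => i.
    by case: (boolP (h i == a)) => //= /eqP /ff' E; rewrite /mag E.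
  by apply: eq_bigr => i hi; rewrite cf.
rewrite ler_pM2l // -[X in _ <= X](mean_cst (coin_sum1 R) 'I_r).
apply: (mean_le (coin_ge0 R)) => s.
have w0 := lw_ge0 Hw.
set E := (q.+1%:R / lam) ^+ q.+1 * _.
pose G i f := `|\sum_j drift i s f j| ^+ q.+1 / t ^+ q.
apply: (@le_trans _ _ (mean p (fun f => t + \sum_i 4 * w i * G i f))).
  apply: mean_le => // f; apply: fmax_le => j.
  have -> : \sum_a sgn R (s a) * tbucket (yy j) a f =
      \sum_i yy j i * \sum_l drift i s f l.
    transitivity (\sum_l sgn R (s (h l)) * coef f l * (nobig (h l) f)%:R * yy j l).
      rewrite [RHS](partition_big h xpredT) //=; apply: eq_bigr => a _.
      rewrite /tbucket /bucket !mulr_sumr; apply: eq_bigr => l /eqP <-.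
      by ring.
    under eq_bigr => l _ do rewrite (lw_repr Hw (Vy j)) mulr_sumr.
    rewrite exchange_big /=; apply: eq_bigr => i _; rewrite mulr_sumr.
    by apply: eq_bigr => l _; rewrite /drift; ring.
  apply: (@le_trans _ _ (\sum_i `|yy j i| * (t + G i f))).
    apply: ler_sum => i _; apply: (le_trans (ler_norm _)); rewrite normrM.
    by apply: ler_wpM2l => //; apply: le_add_pow.
  under eq_bigr do rewrite mulrDr.
  rewrite big_split /= -mulr_suml; apply: lerD.
    by rewrite ler_piMl ?y1 // ltW.
  apply: ler_sum => i _; apply: ler_wpM2r.
    by rewrite divr_ge0 ?exprn_ge0 // ltW.
  apply: (le_trans (coord_le_norm_1 Hw i (Vy j))).
  by rewrite ler_piMr // mulr_ge0.
rewrite meanD mean_cst // lerD2l mean_sum.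
apply: (@le_trans _ _ (\sum_i 4 * w i * (2 * E / t ^+ q))).
  apply: ler_sum => i _; rewrite meanZl; apply: ler_wpM2l; first by rewrite mulr_ge0.
  rewrite meanZr; apply: ler_wpM2r; first by rewrite invr_ge0 exprn_ge0 // ltW.
  by rewrite /E mulrA; apply: drift_pow_moment.
rewrite -mulr_suml -mulr_sumr.
have E0 : 0 <= E / t ^+ q.
  by rewrite divr_ge0 ?mulr_ge0 ?expR_ge0 ?exprn_ge0 ?divr_ge0 // ltW.
rewrite -![_ * E / _]mulrA; have := ler_wpM2r E0 (lw_sum Hw); lra.
Qed.

End MainTerm.

Section UpperBound.
Variables (d : R) (N : nat).
Hypothesis d_gt0 : 0 < d.
Let be := d^-1.

Let be_gt0 : 0 < be. Proof. by rewrite invr_gt0. Qed.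

(** Vector-valued, so that the small jumps of [bucket y a f] are its inner product with the [x]
    representing [y]: one norm bound serves all [y]. *)
Definition small_part a f : 'rV[R]_k :=
  \sum_(j | h j == a) (coef f j * (mag f j * w j <= be)%R%:R) *: b j.

Definition medium f : R :=
  \sum_j w j * (mag f j * (be < mag f j * w j <= be * 2 ^+ N)%R%:R).

(** Cross terms vanish because the signs are independent and centred; the truncated second moment
    bounds the diagonal term of [j] by [be * w j]. *)
Lemma small_part_mean : mean p (fun f => \sum_a dot (small_part a f) (small_part a f)) <= be * S.
Proof.
pose c (t : T) j : R := sgn R t.1 * (tailW R t.2 * (tailW R t.2 * w j <= be)%R%:R).
have c_mean j : mean1 p (fun t => c t j) = 0.
  rewrite /mean1 -(pair_big xpredT xpredT (fun s i => p (s, i) * c (s, i) j)) /=.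
  rewrite big_bool -big_split /= big1 // => i _.
  by rewrite /signedp /coin /c /sgn /= expr0 expr1; ring.
have E a f : dot (small_part a f) (small_part a f) =
   \sum_(j | h j == a) \sum_(i | h i == a) c (f j) j * c (f i) i * dot (b j) (b i).
  rewrite /small_part dot_suml; apply: eq_bigr => j _.
  rewrite dotZl dotC dot_suml mulr_sumr; apply: eq_bigr => i _.
  by rewrite dotZl dotC /c /coef /mag; ring.
rewrite mean_sum; under eq_bigr => a _ do rewrite (eq_mean _ (E a)).
have w0 := lw_ge0 Hw.
apply: (@le_trans _ _ (\sum_a \sum_(j | h j == a) be * w j)).
  apply: ler_sum => a _; rewrite mean_sum; apply: ler_sum => j hj.
  rewrite mean_sum (bigD1 j) //= big1 ?addr0 => [|i /andP[_ ij]]; last first.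
    rewrite meanZr (mean_coord2 p_sum1 (fun t => c t j) (fun t => c t i)) 1?eq_sym //.
    by rewrite c_mean !mul0r.
  rewrite (lw_norm Hw) meanZr (mean_coord p_sum1 j (fun t => c t j * c t j)).
  have := @tail_sqr_le R eps K eps_ge0 (w j) be (w0 j) (ltW be_gt0).
  have -> : mean1 p (fun t => c t j * c t j) = mean1 p (fun x =>
      tailW R x.2 ^+ 2 * (tailW R x.2 * w j <= be)%R%:R).
    apply: eq_bigr => t _; congr (_ * _).
    rewrite /c -expr2 exprMn sgn_sqr mul1r exprMn; congr (_ * _).
    by case: (_ <= be); rewrite ?expr1n ?expr0n.
  move=> /(ler_wpM2r (w0 j)); rewrite -mulrA -expr2 => hh; apply: (le_trans hh).
  by apply: ler_wpM2r => //; rewrite ler_piMl // ltW.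
rewrite sum_buckets -mulr_sumr ler_pM2l //; exact: (lw_sum Hw).
Qed.

Lemma medium_mean : mean p medium <= N%:R * S.
Proof.
have w0 := lw_ge0 Hw.
rewrite /medium mean_sum; apply: (@le_trans _ _ (\sum_j w j * N%:R)).
  apply: ler_sum => j _; rewrite meanZl; apply: ler_wpM2l => //.
  rewrite (mean_coord p_sum1 j (fun t => tailW R t.2 *
     (be < tailW R t.2 * w j <= be * 2 ^+ N)%R%:R)).
  apply: (le_trans (@tail_window_le R eps K eps_ge0 (w j) be N be_gt0 (w0 j))).
  by rewrite ler_piMl //; have := eps_le1; lra.
by rewrite -mulr_suml mulrC; apply: ler_wpM2l => //; apply: (lw_sum Hw).
Qed.

Lemma huge_mean t : 0 < t ->
  mean p (fun f => \sum_j (t < mag f j * w j)%R%:R) <= S / t.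
Proof.
move=> t0; rewrite mean_sum; apply: (@le_trans _ _ (\sum_j w j / t)).
  apply: ler_sum => j _; have w0 := lw_ge0 Hw j.
  rewrite (mean_coord p_sum1 j (fun x => (t < tailW R x.2 * w j)%R%:R)).
  apply: (le_trans (@tail_gt_le R eps K eps_ge0 (w j) t w0 t0)).
  by rewrite ler_piMl // divr_ge0 // ltW.
by rewrite -mulr_suml; apply: ler_wpM2r; [rewrite invr_ge0 ltW | apply: (lw_sum Hw)].
Qed.

(** Here [d] is a threshold parameter, later [M ^+ 16]. Since [dot x x <= 16], AM-GM at scale [d]
    charges each bucket [8 / d], hence [8 d] in all when [r = d^2], and the squared norms have mean
    at most [S / d]. *)
Lemma bucket_upper y f : V y -> norm_1 y = 1 ->
    (forall j, mag f j * w j <= be * 2 ^+ N) ->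
  \sum_a `|bucket y a f| <=
  d / 2 * (\sum_a dot (small_part a f) (small_part a f)) + 8 * r%:R / d + 4 * medium f.
Proof.
move=> Vy y1 small; have w0 := lw_ge0 Hw.
have [x Ex Hx] := lw_coord Hw Vy.
rewrite -/(norm_1 y) y1 expr1n mulr1 in Hx.
apply: (@le_trans _ _ (\sum_a (d / 2 * dot (small_part a f) (small_part a f) + 8 / d
    + \sum_(j | h j == a) 4 * (w j * (mag f j * (be < mag f j * w j <= be * 2 ^+ N)%R%:R))))).
  apply: ler_sum => a _.
  have -> : bucket y a f = dot (small_part a f) x +
      \sum_(j | h j == a) coef f j * (be < mag f j * w j)%R%:R * y j.
    have -> : dot (small_part a f) x =
        \sum_(j | h j == a) coef f j * (mag f j * w j <= be)%R%:R * y j.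
      by rewrite /small_part dot_suml; apply: eq_bigr => j _; rewrite dotZl Ex.
    rewrite -big_split; apply: eq_bigr => j _ /=.
    by case: leP => _; rewrite ?mulr1 ?mulr0 ?mul0r ?addr0 ?add0r.
  apply: (le_trans (ler_normD _ _)); apply: lerD.
    rewrite ler_norml; have dd := dot_amgm x (small_part a f) d_gt0.
    have dn := dot_amgm (- x) (small_part a f) d_gt0.
    have xd : dot x x / d <= 16 / d by rewrite ler_pM2r ?invr_gt0.
    rewrite -scaleN1r !dotZl dotZr !mulN1r opprK in dn.
    by rewrite dotC; apply/andP; split; lra.
  apply: (le_trans (ler_norm_sum _ _ _)); apply: ler_sum => j _.
  rewrite 2!normrM coef_norm small andbT normr_nat.
  have m0 := mag_ge0 f j; have := coord_le_norm_1 Hw j Vy; rewrite y1 mulr1 => hy.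
  have c0 : 0 <= mag f j * (be < mag f j * w j)%R%:R by rewrite mulr_ge0.
  by apply: (le_trans (ler_wpM2l c0 hy)); lra.
rewrite !big_split /= -mulr_sumr sumr_const card_ord.
have -> : \sum_a \sum_(j | h j == a) 4 * (w j * (mag f j *
    (be < mag f j * w j <= be * 2 ^+ N)%R%:R)) = 4 * medium f.
  by rewrite sum_buckets /medium mulr_sumr.
rewrite -[_ *+ r]mulr_natr lerD2r lerD2l; lra.
Qed.

End UpperBound.
End HeavyTailedSketch.

(** * Choice of parameters *)

Section Assembly.
Variables (R : realType) (n k r m : nat) (V : ('I_n -> R) -> Prop) (S : R).
Variables (b : 'I_n -> 'rV[R]_k) (w : 'I_n -> R) (v : 'I_n -> 'I_n -> R).
Hypothesis Hw : lewis_weights V S b w v.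
Variable eps : R.
Hypotheses (eps_gt0 : 0 < eps) (eps_lt1 : eps < 1) (n_gt0 : (0 < n)%N) (m_gt0 : (0 < m)%N).
Local Notation M := (2 ^+ m : R).
Hypotheses (r_eq : r%:R = M ^+ 32 :> R) (S_le : 2 ^+ 20 * S <= M ^+ 16).

(* A coordinate is heavy when w_j >= theta; the scales that count for the lower
   bound are u0 < W_j w_j <= u0 2^m = M^-4.  The dimension d is O(M^16), and the
   powers of M are spaced so that the error terms are small constants or negative
   powers of M. *)
Let K := (n + 8)%N.
Let theta := (M ^+ 6)^-1.
Let u0 := (M ^+ 5)^-1.
Let D := M ^+ 16.
Local Notation p := (signedp eps (K := K)).
Implicit Types (h : {ffun 'I_n -> 'I_r}) (f : {ffun 'I_n -> bool * 'I_K.+1}).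

Let Mge2 : 2 <= M. Proof. by rewrite -[X in X <= _]expr1 ler_weXn2l // ler1n. Qed.
Let M_gt0 : 0 < M. Proof. exact: pow2_gt0. Qed.
Let Mpow_gt0 i : 0 < M ^+ i. Proof. by rewrite exprn_gt0. Qed.
Let Mpow_ge1 i : 1 <= M ^+ i. Proof. by rewrite exprn_ege1 // pow2_ge1. Qed.
Let Mpow_le i j : (i <= j)%N -> M ^+ i <= M ^+ j.
Proof. by move=> ij; rewrite ler_weXn2l // pow2_ge1. Qed.
Let theta_gt0 : 0 < theta. Proof. by rewrite invr_gt0. Qed.
Let u0_gt0 : 0 < u0. Proof. by rewrite invr_gt0. Qed.
Let D_gt0 : 0 < D. Proof. exact: Mpow_gt0. Qed.
Let r_gt0 : (0 < r)%N. Proof. by rewrite -(ltr0n R) r_eq. Qed.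
Let S0 : 0 <= S. Proof. exact: S_ge0 Hw. Qed.
Let S_D : S <= D / 2 ^+ 20. Proof. by rewrite ler_pdivlMr ?pow2_gt0 // mulrC. Qed.
Let theta_u0 : theta <= u0. Proof. by rewrite lef_pV2 ?posrE ?Mpow_le. Qed.
Let eps_ge0 : 0 <= eps. Proof. exact: ltW. Qed.
Let eps_le1 : eps <= 1. Proof. exact: ltW. Qed.
Let p_ge0 t : 0 <= p t. Proof. exact: signedp_ge0. Qed.
Let p_sum1 : \sum_t p t = 1. Proof. exact: signedp_sum1. Qed.

(** Three terms of at most [1/32]. In the middle one [S / (theta * r) <= M^-10], so its square times
    [S] is at most [2^-20]. *)
Let collision_budget :
  2 * (1 / 64) + (S / (theta * r%:R)) ^+ 2 * S / (2 * (1 / 64)) + 1 / 32 <= 3 / 32.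
Proof.
have qE : S / (theta * r%:R) = S / M ^+ 26.
  rewrite r_eq /theta (_ : M ^+ 32 = M ^+ 6 * M ^+ 26) -?exprD //.
  by rewrite exprD mulKf // gt_eqF.
have q10 : S / M ^+ 26 <= (M ^+ 10)^-1.
  rewrite ler_pdivrMr // (_ : M ^+ 26 = M ^+ 10 * M ^+ 16) -?exprD //.
  rewrite exprD mulKf ?gt_eqF //; apply: le_trans S_le.
  by rewrite ler_peMl // exprn_ege1 // ler1n.
have q0 : 0 <= S / M ^+ 26 by rewrite divr_ge0 // ltW.
have q2 : (S / M ^+ 26) ^+ 2 <= (M ^+ 10)^-1 ^+ 2.
  by rewrite lerXn2r // nnegrE ?invr_ge0 // ltW.
have h : (S / M ^+ 26) ^+ 2 * S <= (2 ^+ 20)^-1.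
  apply: (@le_trans _ _ ((M ^+ 10)^-1 ^+ 2 * (D / 2 ^+ 20))).
    by apply: ler_pM; rewrite ?sqr_ge0.
  rewrite mulrA ler_piMl ?invr_ge0 ?(ltW (pow2_gt0 _ _)) //.
  rewrite exprVn -(exprM M 10 2) mulrC ler_pdivrMr // mul1r; exact: Mpow_le.
have c20 : (2 ^+ 20)^-1 <= (2 ^+ 10)^-1 :> R.
  by rewrite lef_pV2 ?posrE ?pow2_gt0 // ler_weXn2l // ler1n.
have c10 : 2 ^+ 10 = 1024 :> R by rewrite -natrX.
have := le_trans h c20; rewrite qE c10.
by move: (_ ^+ 2 * S) => z; lra.
Qed.

(** Heavy mass at least [1/2] makes the first block at least [1/2 - 2/8]. Otherwise the mean of the
    second block is at least [eps * m / 16], and the allowed deviation takes half of it. *)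
Lemma sketch_lower h f y : V y -> norm_1 y = 1 ->
    \sum_i 4 * w i * (coll_dev w v theta i h ^+ 2 / (1 / 32)) <= 1 / 32 ->
    (forall a, load w theta h a <= u0 / 2) ->
    \sum_a (mean p (fun f' => `|tbucket w h u0 m y a f'|) - `|tbucket w h u0 m y a f|)
      <= eps * m%:R / 32 ->
  eps * m%:R / 32 <=
    m%:R * (\sum_a `|\sum_(j | h j == a) y j|) + \sum_a `|bucket h y a f|.
Proof.
move=> Vy y1 Hc Hl Hd; have w0 := lw_ge0 Hw.
have m1 : 1 <= m%:R :> R by rewrite ler1n.
have e1 := eps_lt1; have e0 := eps_gt0.
set X := \sum_a `|\sum_(j | _) _|; set Z := \sum_a `|bucket h y a f|.
have X0 : 0 <= X by apply: sumr_ge0.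
have Z0 : 0 <= Z by apply: sumr_ge0.
pose C := \sum_j ncoll w theta h j * `|y j|.
have nc0 j : 0 <= ncoll w theta h j by apply: sumr_ge0.
have HC : C <= 1 / 8.
  have a0 : 0 < 1 / 64 :> R by lra.
  have t0 : 0 < 1 / 32 :> R by lra.
  apply: (le_trans (collision_uniform Hw r_gt0 theta_gt0 h Vy a0 t0)).
  by rewrite y1 mulr1; have := collision_budget; lra.
have hv := heavy_le w theta h y; rewrite -/X -/C in hv.
pose Hs := \sum_(j | theta <= w j) `|y j|; rewrite -/Hs in hv.
have [hH|hH] := leP (1 / 2) Hs; first by nra.
(* What [P] excludes is heavy mass below [1/2], tiny weights of total [n * 4 / (128 n) = 1/32], and
   collisions of at most [1/8]; more than [1/4] remains. With [ncoll = 0] the bucket of [j] has no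
   heavy coordinate, so the light load bounds all its other weights. *)
pose P j := [&& w j < theta, 1 <= 128 * n%:R * w j & ncoll w theta h j == 0].
have HP : 1 / 4 <= \sum_(j | P j) `|y j|.
  have : norm_1 y <= Hs + (\sum_(j | P j) `|y j| + (\sum_(j < n) 4 / (128 * n%:R) + C)).
    have EH : Hs = \sum_j if theta <= w j then `|y j| else 0 by rewrite /Hs big_mkcond.
    have EP : \sum_(j | P j) `|y j| = \sum_j if P j then `|y j| else 0 by rewrite big_mkcond.
    rewrite EH EP /C /norm_1 -!big_split /=; apply: ler_sum => j _.
    have n0 : 0 < 128 * n%:R :> R by rewrite mulr_gt0 // ltr0n.
    have c0 : 0 <= 4 / (128 * n%:R) :> R by rewrite divr_ge0 // ltW.
    have nn := nc0 j; have yy := normr_ge0 (y j).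
    have ny := mulr_ge0 nn yy.
    rewrite /P; have [h1|h1] := leP theta (w j) => /=; first by lra.
    have [h2|h2] := leP 1 (128 * n%:R * w j) => /=; last first.
      have hw : w j <= (128 * n%:R)^-1.
        by rewrite -[X in _ <= X]mul1r ler_pdivlMr // mulrC ltW.
      by have := coord_le_norm_1 Hw j Vy; rewrite y1 mulr1; lra.
    have [h3|h3] := eqVneq (ncoll w theta h j) 0; first by lra.
    suff : 1 <= ncoll w theta h j by move=> /(ler_wpM2r yy); lra.
    have [[i /andP[hi hij]]|none] :=
      pselect (exists i, heavier w theta j i && (h j == h i)).
      rewrite /ncoll (bigD1 i) //= hij lerDl; exact: sumr_ge0.
    case/eqP: h3; rewrite /ncoll big1 // => i hi.
    by case: eqP => // /eqP hij; case: none; exists i; rewrite hi.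
  have -> : \sum_(j < n) 4 / (128 * n%:R) = 1 / 32 :> R.
    rewrite sumr_const card_ord -[_ *+ n]mulr_natr.
    have : n%:R != 0 :> R by rewrite pnatr_eq0 -lt0n.
    by move: (n%:R) => N N0; field.
  by rewrite y1; lra.
have main : eps / 4 * m%:R * \sum_(j | P j) `|y j| <=
    \sum_a mean p (fun f' => `|tbucket w h u0 m y a f'|).
  apply: (tbucket_mean_ge Hw eps_ge0 eps_le1 u0_gt0) => j /and3P[h1 h2 /eqP h3]; split.
  - by apply: le_trans theta_u0; apply: ltW.
  (* Here the cutoff [K = n + 8] is needed: [2 ^+ K = 256 * 2 ^+ n] exceeds [128 * n], so magnitudes
     reach past [u1 <= 1]. *)
  - have n0 : 0 < n%:R :> R by rewrite ltr0n.
    have nK : n%:R <= 2 ^+ n :> R by rewrite -natrX ler_nat ltnW // ltn_expl.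
    have K8 : 2 ^+ K = 256 * 2 ^+ n :> R.
      by rewrite /K exprD mulrC; congr (_ * _); rewrite -natrX.
    apply: (@le_lt_trans _ _ 1).
      rewrite /u0 mulrC ler_pdivrMr // mul1r -[X in X <= _]expr1.
      exact: Mpow_le.
    rewrite K8; apply: (le_lt_trans h2).
    have wj : 0 < w j.
      rewrite lt_neqAle w0 andbT; apply/eqP => E; move: h2; rewrite -E; lra.
    rewrite ltr_pM2r //; lra.
  apply: le_trans (Hl (h j)); rewrite /load big_mkcond [X in _ <= X]big_mkcond.
  apply: ler_sum => i _; case: ifP => [/andP[ij hij]|_]; last by case: ifP.
  rewrite hij /=; case: (ltP (w i) theta) => // hi.
  have hj : heavier w theta j i.
    by rewrite /heavier eq_sym ij hi andbT; apply: (le_trans (ltW h1)).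
  have : 1 <= ncoll w theta h j.
    by rewrite /ncoll (bigD1 i) //= eq_sym hij lerDl sumr_ge0.
  by rewrite h3 ler10.
rewrite sumrB in Hd.
have tb : \sum_a `|tbucket w h u0 m y a f| <= Z.
  apply: ler_sum => a _; rewrite /tbucket normrM normr_nat ler_piMl //.
  by case: (nobig _ _ _ _ _ _).
have em : 0 <= eps / 4 * m%:R by nra.
have := ler_wpM2l em HP.
have mX : 0 <= m%:R * X by rewrite mulr_ge0.
lra.
Qed.

Lemma sketch_upper h f y : V y -> norm_1 y = 1 ->
    (forall j, mag R f j * w j <= D) ->
    \sum_a dot (small_part b w h D a f) (small_part b w h D a f) <= 1 ->
    medium w D (32 * m) f <= m%:R * D ->
  m%:R * (\sum_a `|\sum_(j | h j == a) y j|) + \sum_a `|bucket h y a f| <=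
  15 * m%:R * D.
Proof.
move=> Vy y1 Hh Hs Hm.
have m1 : 1 <= m%:R :> R by rewrite ler1n.
(* From [D^-1] to [D = 2 ^+ (16 * m)] there are [32 * m] doublings. *)
have DD : D^-1 * 2 ^+ (32 * m) = D.
  by rewrite mulnC exprM (_ : M ^+ 32 = D * D) ?mulKf ?gt_eqF // -exprD.
have := @bucket_upper _ _ _ _ _ _ _ _ _ _ Hw h D (32 * m) D_gt0 y f Vy y1.
rewrite DD => /(_ Hh).
have -> : 8 * r%:R / D = 8 * D.
  have E : M ^+ 32 = D * D by rewrite -exprD.
  by rewrite r_eq E mulrA mulfK // gt_eqF.
have X1 : \sum_a `|\sum_(j | h j == a) y j| <= 1.
  rewrite -y1 /norm_1 -(sum_buckets h); apply: ler_sum => a _; exact: ler_norm_sum.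
have D1 : 1 <= D by apply: Mpow_ge1.
have D0 := D_gt0.
have := ler_wpM2l (ltW (lt_le_trans ltr01 m1)) X1.
have := ler_wpM2l (ltW D0) Hs.
have : m%:R <= m%:R * D by rewrite ler_peMr // (le_trans _ m1).
have : D <= m%:R * D by rewrite ler_peMl // ltW.
lra.
Qed.

Hypotheses (V0 : V (fun=> 0)) (VZ : forall c y, V y -> V (fun j => c * y j)).
(** [132 = 4 * 33] comes from [exp (M / 4) >= (M / 132)^33], which beats the [M^32] buckets;
    [36 = 4 * 9] comes from a ninth moment of order [M^-18], which beats [S <= M^16]. *)
Hypothesis M_load : 2000 * 132 ^+ 33 <= M.
Hypothesis M_dev : 32 * 36 ^+ 9 * (64 * 1000) <= M * (eps * (eps / (128 * 1000)) ^+ 8).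

Let S_D1024 : 1024 * 1024 * S <= D.
Proof.
have c10 : 2 ^+ 10 = 1024 :> R by rewrite -natrX.
have E : 2 ^+ 20 = 1024 * 1024 :> R by rewrite (exprD 2 10 10) c10.
by rewrite -E.
Qed.

Let sgap h y f : R :=
  \sum_a (mean p (fun f' => `|tbucket w h u0 m y a f'|) - `|tbucket w h u0 m y a f|).

Let sgap_mean h (J : finType) (j0 : J) (yy : J -> 'I_n -> R) :
    (forall j, V (yy j)) -> (forall j, norm_1 (yy j) <= 1) ->
  mean p (fun f => fmax j0 (fun j => sgap h (yy j) f)) <= eps / (32 * 1000).
Proof.
move=> Vy y1.
have e0 := eps_gt0; have e1 := eps_lt1; have M2 := Mge2.
pose t := eps / (128 * 1000); have t0 : 0 < t by rewrite /t; lra.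
(* As [u1 = M^-4], this makes the exponent [8 * lam^2 * eps * u1] equal to [eps / 2]. The [t] above
   is a quarter of the target. *)
pose lam := M ^+ 2 / 4; have lam0 : 0 < lam by rewrite divr_gt0.
have u1E : u0 * M = (M ^+ 4)^-1.
  by rewrite /u0 (exprSr M 4) invfM -mulrA mulVf ?mulr1 // gt_eqF.
have lamu : lam * (4 * (u0 * M)) = (M ^+ 2)^-1.
  by rewrite u1E /lam (exprD M 2 2); field; rewrite gt_eqF.
have hl : lam * (4 * (u0 * M)) <= 1 / 2.
  rewrite lamu div1r lef_pV2 ?posrE //; apply: (le_trans M2).
  by rewrite -[X in X <= _]expr1; apply: Mpow_le.
apply: (le_trans (tbucket_deviation K Hw eps_ge0 eps_le1 h u0_gt0 j0 8 Vy y1 lam0 hl t0)).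
have -> : 8 * lam ^+ 2 * (eps * (u0 * M)) = eps / 2.
  by rewrite u1E /lam (exprD M 2 2); field; rewrite gt_eqF.
have ex : expR (eps / 2) <= 2.
  by apply: (le_trans (@expR_le_quad _ (eps / 2) _)); [lra | nra].
have -> : 9%:R / lam = 36 / M ^+ 2 by rewrite /lam; field; rewrite gt_eqF.
rewrite exprMn exprVn -(exprM M 2 9).
have t8 : 0 < t ^+ 8 by rewrite exprn_gt0.
suff : 8 * S * (36 ^+ 9 / M ^+ 18 * expR (eps / 2)) / t ^+ 8 <= eps / (128 * 1000).
  by rewrite -/t; have -> : eps / (32 * 1000) = 2 * (t + t) by [rewrite /t; lra]; lra.
rewrite ler_pdivrMr //.
have c36 : 0 < 36 ^+ 9 :> R by rewrite exprn_gt0.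
apply: (@le_trans _ _ (8 * M ^+ 16 * (36 ^+ 9 / M ^+ 18 * 2))).
  have S16 : S <= M ^+ 16 by have := S_D1024; have := S0; rewrite /D; lra.
  have c18 : 0 < 36 ^+ 9 / M ^+ 18 by rewrite divr_gt0.
  apply: ler_pM.
  - by rewrite mulr_ge0 // S0.
  - by apply: mulr_ge0; [exact: ltW | exact: expR_ge0].
  - by rewrite ler_pM2l.
  - by rewrite ler_pM2l.
have -> : 8 * M ^+ 16 * (36 ^+ 9 / M ^+ 18 * 2) = 16 * 36 ^+ 9 / M ^+ 2.
  by rewrite (exprD M 16 2); field; rewrite !gt_eqF.
rewrite ler_pdivrMr //.
have MM : M <= M ^+ 2 by rewrite -[X in X <= _]expr1; apply: Mpow_le.
have et : 0 <= eps * t ^+ 8 by rewrite mulr_ge0 ?ltW.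
have := ler_wpM2l et MM; have hM := M_dev; rewrite -/t in hM; move: hM; move: (36 ^+ 9) (t ^+ 8) (M ^+ 2) (M) => x y z u; lra.
Qed.

Let overload_small :
  mean (unif R (r := r)) (fun h => \sum_a (u0 / 2 < load w theta h a)%R%:R) <= 1 / 1000.
Proof.
have M2 := Mge2; have Mp := M_gt0; have w0 := lw_ge0 Hw.
(* The largest [s] with [s * theta <= 1/2]. Then [s * u0 / 2 = M / 4], whereas the mean load
   contributes at most [1/2] to the exponent. *)
pose s := M ^+ 6 / 2; have s0 : 0 <= s by rewrite divr_ge0 // ltW.
have hs : s * theta <= 1 / 2 by rewrite /s /theta mulrAC mulfV ?gt_eqF.
apply: (le_trans (overload_mean w0 (lw_sum Hw) r_gt0 (u0 / 2) s0 hs)).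
have -> : s * (u0 / 2) = M / 4.
  by rewrite /s /u0 (exprSr M 5); field; rewrite gt_eqF.
have sr : 2 * s * S / r%:R <= 1 / 2.
  rewrite r_eq /s ler_pdivrMr //.
  have h1 : S <= M ^+ 16 by have := S_D1024; have := S0; rewrite /D; lra.
  have h2 : M ^+ 6 * M ^+ 16 * M <= M ^+ 32 by rewrite -exprD -exprSr; apply: Mpow_le.
  have h3 := ler_wpM2l (ltW (Mpow_gt0 6)) h1.
  have h4 : 0 <= M ^+ 6 * M ^+ 16 by rewrite mulr_ge0 // ltW.
  have h5 := ler_wpM2l h4 M2; lra.
have e1 : expR (2 * s * S / r%:R - M / 4) <= 2 * (expR (M / 4))^-1.
  rewrite expRD expRN; apply: ler_wpM2r; first by rewrite invr_ge0 expR_ge0.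
  apply: (@le_trans _ _ (expR (1 / 2))); first by rewrite ler_expR.
  by apply: (le_trans (@expR_le_quad _ (1 / 2) _)); lra.
have M4 : 0 <= M / 4 by rewrite divr_ge0 // ltW.
have e2 := @expR_ge_pow _ (M / 4) 33 isT M4.
have c0 : 0 < 132 ^+ 33 :> R by rewrite exprn_gt0.
have e3 : (M / 4 / 33%:R) ^+ 33 = M ^+ 33 / 132 ^+ 33.
  by rewrite -expr_div_n; congr (_ ^+ _); field.
rewrite e3 in e2.
apply: (le_trans (ler_wpM2l _ e1)) => //.
have e4 : (expR (M / 4))^-1 <= 132 ^+ 33 / M ^+ 33.
  by rewrite -[X in _ <= X]invf_div lef_pV2 ?posrE ?expR_gt0 ?divr_gt0.
rewrite r_eq; apply: (@le_trans _ _ (M ^+ 32 * (2 * (132 ^+ 33 / M ^+ 33)))).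
  by apply: ler_wpM2l; [exact: ltW | lra].
have -> : M ^+ 32 * (2 * (132 ^+ 33 / M ^+ 33)) = 2 * 132 ^+ 33 / M.
  by rewrite (exprSr M 32); move: (132 ^+ 33) => c; field; rewrite !gt_eqF.
rewrite ler_pdivrMr //; have := M_load; lra.
Qed.

Let coll_small : mean (unif R (r := r)) (fun h =>
  \sum_i 4 * w i * (coll_dev w v theta i h ^+ 2 / (1 / 32))) <= 1 / (32 * 1000).
Proof.
have w0 := lw_ge0 Hw.
rewrite mean_sum; apply: (@le_trans _ _ (\sum_i 4 * w i * (8 * S / r%:R / (1 / 32)))).
  apply: ler_sum => i _; rewrite meanZl; apply: ler_wpM2l; first by rewrite mulr_ge0.
  rewrite meanZr; apply: ler_wpM2r; first by rewrite invr_ge0 divr_ge0.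
  exact: (collision_dev Hw).
rewrite -mulr_suml -mulr_sumr r_eq.
have E : M ^+ 32 = D * D by rewrite -exprD.
have h0 : 0 <= 8 * S / M ^+ 32 / (1 / 32) by rewrite !divr_ge0 ?mulr_ge0 ?S0 ?ltW.
have hs := lw_sum Hw; have sd := S_D1024; have s0 := S0; have d0 := D_gt0.
apply: (@le_trans _ _ (4 * S * (8 * S / M ^+ 32 / (1 / 32)))).
  by apply: ler_wpM2r => //; rewrite ler_pM2l.
have q0 : 0 <= S / D by rewrite divr_ge0 // ltW.
have q1 : S / D <= 1 / 1024 / 1024 by rewrite ler_pdivrMr //; lra.
have -> : 4 * S * (8 * S / M ^+ 32 / (1 / 32)) = 1024 * (S / D) * (S / D).
  by rewrite E; field; rewrite gt_eqF.
move: (S / D) q0 q1 => q q0 q1; nra.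
Qed.

(** [phi] adds six error quantities, each scaled so that its mean is at most [1/1000] and so that
    [phi < 1] forces every requirement at once. Homogeneity ([VZ]) reduces to norm 1. *)
Lemma sketch_good : exists phi : {ffun 'I_n -> 'I_r} -> {ffun 'I_n -> bool * 'I_K.+1} -> R,
  [/\ forall h f, 0 <= phi h f,
      mean (unif R (r := r)) (fun h => mean p (phi h)) <= 1 / 100 &
      forall h f, phi h f < 1 -> forall y, V y ->
        let len := m%:R * (\sum_a `|\sum_(j | h j == a) y j|) + \sum_a `|bucket h y a f| in
        eps * m%:R / 32 * norm_1 y <= len /\ len <= 15 * m%:R * D * norm_1 y].
Proof.
have w0 := lw_ge0 Hw; have e0 := eps_gt0; have d0 := D_gt0.
have m1 : 1 <= m%:R :> R by rewrite ler1n.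
have em0 : 0 < eps * m%:R / 32 by rewrite divr_gt0 // mulr_gt0 //; lra.
pose bad h f y := [/\ V y, norm_1 y <= 1 & eps * m%:R / 32 < sgap h y f].
(* For each outcome a violating [y] is chosen if one exists, else 0, whose gap is 0. For fixed [h]
   the maximum then runs over the choices of all [f], a family independent of the current [f], as
   the deviation bound demands. *)
have [yy Hyy] : exists yy, forall h f, [/\ V (yy h f), norm_1 (yy h f) <= 1,
    0 <= sgap h (yy h f) f & (exists y, bad h f y) -> eps * m%:R / 32 < sgap h (yy h f) f].
  have H h f : exists y, [/\ V y, norm_1 y <= 1, 0 <= sgap h y f &
      (exists y, bad h f y) -> eps * m%:R / 32 < sgap h y f].
    have [[y [h1 h2 h3]]|no] := pselect (exists y, bad h f y).
      by exists y; split => //; apply: ltW; apply: lt_trans h3.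
    exists (fun=> 0); split => //.
      by rewrite /norm_1 big1 // => j _; rewrite normr0.
    have tb0 a f' : tbucket w h u0 m (fun=> 0) a f' = 0.
      by rewrite /tbucket /bucket big1 ?mulr0 // => j _; rewrite mulr0.
    rewrite /sgap big1 // => a _; rewrite tb0 normr0 subr0.
    by rewrite /mean big1 // => f' _; rewrite tb0 normr0 mulr0.
  exists (fun h f => projT1 (cid (H h f))) => h f.
  by case: (cid (H h f)).
pose f0 : {ffun 'I_n -> bool * 'I_K.+1} := [ffun=> (true, ord0)].
pose dev h f := fmax f0 (fun j => sgap h (yy h j) f).
pose c1 h := \sum_i 4 * w i * (coll_dev w v theta i h ^+ 2 / (1 / 32)).
pose c2 h : R := \sum_a (u0 / 2 < load w theta h a)%R%:R.
pose c3 f : R := \sum_j (D < mag R f j * w j)%R%:R.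
pose c4 h f := \sum_a dot (small_part b w h D a f) (small_part b w h D a f).
have c1_ge0 h : 0 <= c1 h.
  by apply: sumr_ge0 => i _; rewrite mulr_ge0 ?divr_ge0 ?sqr_ge0 // mulr_ge0.
have c2_ge0 h : 0 <= c2 h by apply: sumr_ge0.
have c3_ge0 f : 0 <= c3 f by apply: sumr_ge0.
have c4_ge0 h f : 0 <= c4 h f by apply: sumr_ge0 => a _; apply: dot_ge0.
have med_ge0 f : 0 <= medium w D (32 * m) f / (m%:R * D).
  apply: divr_ge0; last by rewrite mulr_ge0 // ltW.
  apply: sumr_ge0 => j _.
  by rewrite mulr_ge0 // mulr_ge0 ?mag_ge0.
have dev_ge0 h f : 0 <= dev h f / (eps * m%:R / 32).
  rewrite divr_ge0 ?(ltW em0) //; have [_ _ hy _] := Hyy h f.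
  exact: (le_trans hy (le_fmax f0 (fun j => sgap h (yy h j) f) f)).
pose phi h f := 32 * c1 h + c2 h + c3 f + c4 h f + medium w D (32 * m) f / (m%:R * D)
  + dev h f / (eps * m%:R / 32).
have SD : S / D <= 1 / 1024 / 1024 by have := S_D1024; rewrite ler_pdivrMr //; lra.
exists phi; split.
- move=> h f; rewrite /phi; have := c1_ge0 h; have := c2_ge0 h; have := c3_ge0 f.
  by have := c4_ge0 h f; have := med_ge0 f; have := dev_ge0 h f; lra.
- apply: (@le_trans _ _ (mean (unif R (r := r)) (fun h : {ffun 'I_n -> 'I_r} =>
    32 * c1 h + (c2 h + 4 / 1000)))).
    apply: (mean_le (@unif_ge0 R r)) => h; rewrite /phi !meanD !mean_cst // meanZr meanZr.
    have k3 : mean p c3 <= 1 / 1000.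
      by apply: (le_trans (huge_mean K Hw eps_ge0 eps_le1 d0)); lra.
    have k4 : mean p (c4 h) <= 1 / 1000.
      apply: (le_trans (small_part_mean K Hw eps_ge0 eps_le1 h d0)).
      by rewrite mulrC; lra.
    have k5 : mean p (medium w D (32 * m)) / (m%:R * D) <= 1 / 1000.
      rewrite ler_pdivrMr ?mulr_gt0 ?ltr0n //.
      apply: (le_trans (medium_mean K Hw eps_ge0 eps_le1 (32 * m) d0)).
      rewrite natrM; have := S_D1024; move/(ler_wpM2l (ltW (lt_le_trans ltr01 m1))).
      by have : 0 <= m%:R * D by [rewrite mulr_ge0 // ltW]; lra.
    have k6 : mean p (dev h) / (eps * m%:R / 32) <= 1 / 1000.
      rewrite ler_pdivrMr // /dev.
      apply: (@le_trans _ _ (eps / (32 * 1000))).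
        by apply: sgap_mean => j; have [] := Hyy h j.
      by have := ler_wpM2l (ltW e0) m1; lra.
    lra.
  rewrite meanD meanD meanZl mean_cst ?unif_sum1 //.
  by have := coll_small; have := overload_small; rewrite -/c1 -/c2; lra.
move=> h f lt1 y Vy.
have q1 := c1_ge0 h; have q2 := c2_ge0 h; have q3 := c3_ge0 f.
have q4 := c4_ge0 h f; have q5 := med_ge0 f; have q6 := dev_ge0 h f.
rewrite /phi in lt1.
have g1 : c1 h <= 1 / 32 by lra.
have g2 a : load w theta h a <= u0 / 2.
  rewrite leNgt; apply/negP => H; have : 1 <= c2 h.
    by rewrite /c2 (bigD1 a) //= H lerDl sumr_ge0.
  lra.
have g3 j : mag R f j * w j <= D.
  rewrite leNgt; apply/negP => H; have : 1 <= c3 f.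
    by rewrite /c3 (bigD1 j) //= H lerDl sumr_ge0.
  lra.
have g4 : c4 h f <= 1 by lra.
have g5 : medium w D (32 * m) f <= m%:R * D.
  by rewrite -[X in _ <= X]mul1r -ler_pdivrMr ?mulr_gt0 ?ltr0n //; lra.
have g6 z : V z -> norm_1 z <= 1 -> sgap h z f <= eps * m%:R / 32.
  move=> Vz z1; rewrite leNgt; apply/negP => H.
  have [_ _ _ hb] := Hyy h f.
  have h1 : eps * m%:R / 32 < dev h f.
    apply: lt_le_trans (le_fmax f0 (fun j => sgap h (yy h j) f) f).
    by apply: hb; exists z.
  have : 1 < dev h f / (eps * m%:R / 32) by rewrite ltr_pdivlMr // mul1r.
  lra.
move=> len.
have [y0|yn] := eqVneq (norm_1 y) 0.
  have yz j : y j = 0.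
    apply/eqP; rewrite -normr_le0 -y0 /norm_1 (bigD1 j) //= lerDl.
    exact: sumr_ge0.
  have -> : len = 0.
    rewrite /len big1 ?mulr0 ?add0r => [|a _]; last by rewrite big1 ?normr0.
    by rewrite big1 // => a _; rewrite /bucket big1 ?normr0 // => j _; rewrite yz mulr0.
  by rewrite y0 !mulr0.
have yp : 0 < norm_1 y by rewrite lt_neqAle eq_sym yn norm_1_ge0.
pose c := (norm_1 y)^-1; have c0 : 0 < c by rewrite invr_gt0.
have z1 : norm_1 (fun j => c * y j) = 1.
  rewrite /norm_1; under eq_bigr do rewrite normrM (gtr0_norm c0).
  by rewrite -mulr_sumr mulVf.
have Vz := VZ c Vy.
have E : m%:R * (\sum_a `|\sum_(j | h j == a) c * y j|)
    + \sum_a `|bucket h (fun j => c * y j) a f| = c * len.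
  rewrite /len mulrDr mulrCA; congr (_ + _); [congr (_ * _)|]; rewrite mulr_sumr;
    apply: eq_bigr => a _.
    by rewrite -mulr_sumr normrM gtr0_norm.
  rewrite /bucket -{2}(gtr0_norm c0) -normrM mulr_sumr; congr (`|_|).
  by apply: eq_bigr => j _; rewrite mulrCA.
have z1_le : norm_1 (fun j => c * y j) <= 1 by rewrite z1.
have := sketch_upper Vz z1 g3 g4 g5; have := sketch_lower Vz z1 g1 g2 (g6 _ Vz z1_le).
rewrite E => /(ler_wpM2r (ltW yp)) + /(ler_wpM2r (ltW yp)).
have -> : c * len * norm_1 y = len by rewrite mulrAC mulVf ?mul1r.
by split.
Qed.

End Assembly.

Lemma exists_scale (R : realType) (eps : R) : 0 < eps ->
  exists m0 : nat, forall m, (m0 <= m)%N ->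
  2000 * 132 ^+ 33 <= 2 ^+ m :> R /\
  32 * 36 ^+ 9 * (64 * 1000) <= 2 ^+ m * (eps * (eps / (128 * 1000)) ^+ 8).
Proof.
move=> e0; pose e' := eps * (eps / (128 * 1000)) ^+ 8.
have e'0 : 0 < e' by rewrite mulr_gt0 // exprn_gt0 // divr_gt0 // mulr_gt0.
pose X1 : R := 2000 * 132 ^+ 33; pose X2 := 32 * 36 ^+ 9 * (64 * 1000) / e'.
exists (maxn (Num.bound X1) (Num.bound X2)) => m; rewrite geq_max => /andP[h1 h2].
split; first exact: (ltW (upper_nthrootP h1)).
by have := upper_nthrootP h2; rewrite /X2 ltr_pdivrMr // => /ltW.
Qed.


(** * Transfer to the concrete reals *)

Local Notation R := Rdefinitions.R.

Lemma rsumE n (f : nat -> R) : rsum n f = \sum_(i < n) f i.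
Proof. by elim: n => [|n IH] /=; rewrite ?big_ord0 // big_ord_recr /= IH. Qed.

Lemma norm1E n (y : nat -> R) : norm1 n y = \sum_(i < n) `|y i|.
Proof. by rewrite /norm1 rsumE; apply: eq_bigr => i _; rewrite RabsE. Qed.

Lemma nnz_colE r (A : nat -> nat -> R) j : nnz_col r A j = (\sum_(i < r) (A i j != 0%R))%N.
Proof.
elim: r => [|r IH] /=; first by rewrite big_ord0.
rewrite big_ord_recr /= IH; congr (_ + _)%N.
by case: (RIneq.Req_EM_T (A r j) 0) => [->|/eqP /negPf ne]; rewrite ?eqxx // ne.
Qed.

Section FiniteSpace.
Variables (T : finType) (wt : T -> R).
Hypotheses (wt_ge0 : forall t, 0 <= wt t) (wt_sum1 : \sum_t wt t = 1).

Definition fprob (E : T -> Prop) : R := \sum_t wt t * `[< E t >]%:R.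

Lemma fprob_ge0 E : True -> Rle 0 (fprob E).
Proof. by move=> _; apply/RleP; apply: sumr_ge0 => t _; apply: mulr_ge0. Qed.

Lemma fprob_full : fprob (fun=> True) = 1.
Proof.
rewrite -wt_sum1; apply: eq_bigr => t _.
by have -> : `[< True >] = true by [apply/asboolP]; rewrite mulr1.
Qed.

(** A point lies in at most one of the events, so the partial sums are constant beyond the largest
    index [idx t] over the finite set. *)
Lemma fprob_cadd (E : nat -> T -> Prop) :
    (forall k : nat, True) -> (forall k l t, k <> l -> E k t -> E l t -> False) ->
  infinite_sum (fun k => fprob (E k)) (fprob (fun t => exists k, E k t)).
Proof.
move=> _ disj.
have [idx Hidx] : exists idx : T -> nat, forall t, (exists k, E k t) -> E (idx t) t.
  have H t : exists k, (exists k, E k t) -> E k t.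
    by have [[k Ek]|no] := pselect (exists k, E k t); [exists k | exists 0%N].
  by exists (fun t => projT1 (cid (H t))) => t; case: (cid (H t)).
move=> e /RltP e0; exists (\max_t idx t)%N => n /ssrnat.leP nN.
rewrite sum_f_R0E (_ : \sum_(0 <= k < n.+1) _ = fprob (fun t => exists k, E k t)).
  by rewrite RdistE subrr normr0; apply/RltP.
rewrite big_mkord /fprob exchange_big /=; apply: eq_bigr => t _.
rewrite -mulr_sumr; congr (_ * _).
have [ex|no] := pselect (exists k, E k t); last first.
  have -> : `[< exists k, E k t >] = false by apply/asboolP.
  rewrite big1 // => k _; have -> : `[< E k t >] = false; last by [].
  by apply/asboolP => Ek; apply: no; exists k.
have -> : `[< exists k, E k t >] = true by apply/asboolP.
have tn : (idx t < n.+1)%N.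
  by rewrite ltnS; apply: leq_trans nN; apply: (leq_bigmax t).
rewrite (bigD1 (Ordinal tn)) //= big1 ?addr0 => [|k kt].
  by have -> : `[< E (idx t) t >] = true by [apply/asboolP; apply: Hidx].
have -> : `[< E k t >] = false; last by [].
apply/asboolP => Ek; apply: (disj (nat_of_ord k) (idx t) t) => //; last exact: Hidx.
by move=> kE; move/eqP: kt; apply; apply: val_inj.
Qed.

Definition finite_space : prob_space :=
  @Build_prob_space T (fun=> True) fprob I (fun _ _ => I) (fun _ _ => I)
    fprob_ge0 fprob_full fprob_cadd.

Lemma expect_natE K (X : T -> nat) : (forall t, X t <= K)%N ->
  expect_nat finite_space K X = \sum_t wt t * (X t)%:R.
Proof.
move=> XK; rewrite /expect_nat rsumE /= /fprob.
under eq_bigr => k _ do rewrite RmultE INRE mulr_sumr.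
rewrite exchange_big /=; apply: eq_bigr => t _.
have Xt : (X t < K.+1)%N by rewrite ltnS.
rewrite (bigD1 (Ordinal Xt)) //= big1 ?addr0 => [|k kt].
  by have -> : `[< X t = X t >] = true by [apply/asboolP]; rewrite mulr1 mulrC.
have -> : `[< X t = k >] = false; last by rewrite !mulr0.
by apply/asboolP => E; move/eqP: kt; apply; apply: val_inj.
Qed.

End FiniteSpace.

Section Embedding.
Variables (n r K m : nat).
Hypothesis m_gt0 : (0 < m)%N.
Local Notation T := ({ffun 'I_n -> 'I_r} * {ffun 'I_n -> bool * 'I_K.+1})%type.

Definition sketch (t : T) (i j : nat) : R :=
  if insub j is Some j' then
    if i == t.1 j' :> nat then m%:R else if i == (r + t.1 j')%N then coef R t.2 j' else 0
  else 0.

Lemma sketch_top t (a : 'I_r) (j : 'I_n) :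
  sketch t a j = if t.1 j == a then m%:R else 0.
Proof.
rewrite /sketch valK; rewrite [_ == nat_of_ord _]eq_sym -val_eqE; case: eqP => // _.
by rewrite ltn_eqF // ltn_addr.
Qed.

Lemma sketch_bot t (a : 'I_r) (j : 'I_n) :
  sketch t (r + a) j = if t.1 j == a then coef R t.2 j else 0.
Proof.
rewrite /sketch valK gtn_eqF; last by rewrite ltn_addr.
by rewrite eqn_add2l eq_sym -val_eqE.
Qed.

Lemma sketch_norm1 t (z : nat -> R) : norm1 (r + r) (matvec n (sketch t) z) =
  m%:R * (\sum_a `|\sum_(j | t.1 j == a) z j|)
    + \sum_a `|bucket t.1 (fun j => z j) a t.2|.
Proof.
rewrite norm1E big_split_ord /=; congr (_ + _).
  rewrite mulr_sumr; apply: eq_bigr => a _; rewrite /matvec rsumE.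
  rewrite -[X in X * _]ger0_norm // -normrM mulr_sumr [in RHS]big_mkcond /=.
  congr (`|_|); apply: eq_bigr => j _; rewrite sketch_top RmultE.
  by case: (t.1 j == a); rewrite ?mul0r.
apply: eq_bigr => a _; rewrite /matvec rsumE /bucket [in RHS]big_mkcond /=.
congr (`|_|); apply: eq_bigr => j _; rewrite sketch_bot RmultE.
by case: (t.1 j == a); rewrite ?mul0r.
Qed.

Lemma sketch_nnz t (j : 'I_n) :
  nnz_col (r + r) (sketch t) j = (1 + (tailW R (t.2 j).2 != 0)%R)%N.
Proof.
rewrite nnz_colE big_split_ord /=; congr (_ + _)%N.
  rewrite (bigD1 (t.1 j)) //= sketch_top eqxx pnatr_eq0 -lt0n m_gt0 big1 // => a aj.
  by rewrite sketch_top [t.1 j == a]eq_sym (negPf aj) eqxx.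
rewrite (bigD1 (t.1 j)) //= sketch_bot eqxx big1 ?addn0 => [|a aj].
  by rewrite /coef /mag mulf_eq0 /sgn signr_eq0.
by rewrite sketch_bot [t.1 j == a]eq_sym (negPf aj) eqxx.
Qed.

End Embedding.

(** [A] enters only after the space is fixed. The last clause allows any [G] containing the good
    event, so constants can be relaxed later without a monotonicity argument. *)
Lemma sketch_space (eps : R) m n d : 0 < eps -> eps < 1 -> (0 < m)%N -> (0 < n)%N ->
    2000 * 132 ^+ 33 <= 2 ^+ m :> R ->
    32 * 36 ^+ 9 * (64 * 1000) <= 2 ^+ m * (eps * (eps / (128 * 1000)) ^+ 8) ->
    2 ^+ 20 * d%:R <= (2 ^+ m) ^+ 16 :> R ->
  let r := (2 ^ (m * 32))%N in
  exists (PS : prob_space) (Pi : sample PS -> nat -> nat -> R),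
  [/\ forall E, meas PS E,
      forall t j, (j < n)%N -> (nnz_col (r + r) (Pi t) j <= 2)%N,
      forall j, (j < n)%N ->
        expect_nat PS (r + r) (fun t => nnz_col (r + r) (Pi t) j) <= 1 + eps &
      forall (A : nat -> nat -> R) (G : sample PS -> Prop),
        (forall t, (forall x,
            eps * m%:R / 32 * norm1 n (matvec d A x)
              <= norm1 (r + r) (matvec n (Pi t) (matvec d A x)) /\
            norm1 (r + r) (matvec n (Pi t) (matvec d A x))
              <= 15 * m%:R * (2 ^+ m) ^+ 16 * norm1 n (matvec d A x)) -> G t) ->
        99 / 100 <= prob PS G].
Proof.
move=> e0 e1 m0 n0 hload hdev hd r.
have r_gt0 : (0 < r)%N by rewrite expn_gt0.
have r_eq : r%:R = (2 ^+ m) ^+ 32 :> R by rewrite /r natrX exprM.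
pose K := (n + 8)%N.
pose p := signedp eps (K := K).
have p_ge0 t : 0 <= p t by apply: signedp_ge0; apply: ltW.
have p_sum1 : \sum_t p t = 1 by apply: signedp_sum1.
have u_ge0 := @unif_ge0 R r; have u_sum1 := unif_sum1 R r_gt0.
pose T : finType := ({ffun 'I_n -> 'I_r} * {ffun 'I_n -> bool * 'I_K.+1})%type.
pose wt (t : T) : R := pweight (unif R (r := r)) t.1 * pweight p t.2.
have wtE (F : T -> R) : \sum_t wt t * F t =
    mean (unif R (r := r)) (fun h => mean p (fun f => F (h, f))).
  have -> : \sum_t wt t * F t = \sum_t wt (t.1, t.2) * F (t.1, t.2) by apply: eq_bigr => -[].
  rewrite /mean -(pair_big xpredT xpredT (fun h f => wt (h, f) * F (h, f))) /=.
  apply: eq_bigr => h _; rewrite mulr_sumr; apply: eq_bigr => f _.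
  by rewrite mulrA.
have wt_ge0 t : 0 <= wt t by rewrite mulr_ge0 ?pweight_ge0.
have wt_sum1 : \sum_t wt t = 1.
  have := wtE (fun=> 1); under eq_bigr do rewrite mulr1.
  by move=> ->; under eq_mean do rewrite mean_cst //; rewrite mean_cst.
have nnz2 (t : T) j : (j < n)%N -> (nnz_col (r + r) (sketch m t) j <= 2)%N.
  move=> jn; rewrite (sketch_nnz m0 t (Ordinal jn)) add1n ltnS.
  by case: (_ != _).
exists (finite_space wt_ge0 wt_sum1), (fun t => sketch m t); split=> //.
- move=> j jn; rewrite expect_natE; last first.
    move=> t; apply: (leq_trans (nnz2 t j jn)).
    by rewrite addnn -[2%N]/(1.*2)%N leq_double.
  have -> : \sum_t wt t * (nnz_col (r + r) (sketch m t) j)%:R =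
     \sum_t wt t * (1 + (tailW R (t.2 (Ordinal jn)).2 != 0)%R%:R).
    by apply: eq_bigr => t _; rewrite (sketch_nnz m0 t (Ordinal jn)) natrD.
  rewrite wtE /=; under eq_mean do rewrite meanD mean_cst //.
  rewrite mean_cst // lerD2l.
  rewrite (mean_coord p_sum1 (Ordinal jn) (fun x => (tailW R x.2 != 0)%R%:R)).
  by apply: tail_neq0_le; apply: ltW.
- move=> A G HG.
  pose A' : 'M[R]_(n, d) := \matrix_(i, j) A i j.
  have [k [b [w [v Hw]]]] := exists_lewis_weights A'.
  have V0 : exists x : 'cV[R]_d, forall j : 'I_n, 0 = (A' *m x) j 0.
    by exists 0 => j; rewrite mulmx0 mxE.
  have VZ c (y : 'I_n -> R) : (exists x : 'cV_d, forall j, y j = (A' *m x) j 0) ->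
      exists x : 'cV_d, forall j, c * y j = (A' *m x) j 0.
    by move=> [x Ex]; exists (c *: x) => j; rewrite -scalemxAr mxE Ex.
  have [phi [phi0 phiE phiG]] := sketch_good Hw e0 e1 n0 m0 r_eq hd V0 VZ hload hdev.
  have good t : phi t.1 t.2 < 1 -> G t.
    move=> lt1; apply: HG => x.
    pose y (j : 'I_n) : R := matvec d A x j.
    have Vy : exists x' : 'cV_d, forall j, y j = (A' *m x') j 0.
      exists (\col_l x l) => j; rewrite /y /matvec rsumE mxE.
      by apply: eq_bigr => l _; rewrite !mxE.
    have := phiG t.1 t.2 lt1 y Vy.
    by rewrite sketch_norm1 norm1E.
  (* Markov's inequality pointwise: [1 - phi] never exceeds the indicator of [G]. *)
  have : \sum_t wt t * (1 - phi t.1 t.2) <= fprob wt G.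
    apply: ler_sum => t _; apply: ler_wpM2l => //.
    have := phi0 t.1 t.2; have [h1|h1] := ltP (phi t.1 t.2) 1; last first.
      by move=> _; apply: (@le_trans _ _ 0); rewrite ?subr_le0.
    have -> : `[< G t >] = true by [apply/asboolP; apply: good].
    by move=> h0; rewrite lerBlDr lerDl.
  rewrite wtE /=.
  under eq_mean do rewrite meanD mean_cst //.
  rewrite meanD mean_cst //.
  have -> : mean (unif R (r := r)) (fun h => mean p (fun f => - phi h f)) =
     - mean (unif R (r := r)) (fun h => mean p (phi h)).
    rewrite -mulN1r -meanZl; apply: eq_mean => h; rewrite -meanZl.
    by apply: eq_mean => f; rewrite mulN1r.
  by move: phiE; rewrite -/p /=; move: (mean _ _) (fprob _ _) => x z; lra.
Qed.

(** * Comparison of the scale with log d *)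

Lemma ln_trunc_log (d t : nat) : (2 ^ t <= d < 2 ^ t.+1)%N ->
  t%:R / 2 <= Rpower.ln (INR d) <= t%:R + 1.
Proof.
move=> /andP[td dt].
have ln2 : / 2 < Rpower.ln 2 by apply/RltP; exact: ln_lt_2.
have two0 : 0 < 2 :> R by [].
have ln21 : Rpower.ln 2 <= 1.
  apply/RleP; rewrite -[X in Rle _ X]ln_exp; apply: Rlt_le; apply: ln_increasing; first by apply/RltP; exact: two0.
  by have := exp_ineq1 1 R1_neq_R0.
have p2 i : Rpower.ln (INR (2 ^ i)) = i%:R * Rpower.ln 2.
  rewrite INRE natrX -RpowE.
  by rewrite ln_pow ?RmultE ?INRE //; apply/RltP; exact: two0.
have pos i : Rlt 0 (INR (2 ^ i)).
  by apply/RltP; rewrite INRE ltr0n expn_gt0.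
have lnle i j : Rlt 0 (INR i) -> (i <= j)%N -> Rpower.ln (INR i) <= Rpower.ln (INR j).
  move=> i0; rewrite leq_eqVlt => /orP[/eqP -> //|ij].
  by apply/RleP; apply: Rlt_le; apply: ln_increasing => //; apply: lt_INR; apply/ssrnat.ltP.
have d0 : Rlt 0 (INR d).
  by apply/RltP; rewrite INRE ltr0n; apply: leq_trans td; rewrite expn_gt0.
have l1 := lnle _ _ (pos t) td; have l2 := lnle _ _ d0 (ltnW dt).
rewrite !p2 -[t.+1%:R]natr1 in l1 l2.
have t0 : 0 <= t%:R :> R by [].
have half : / 2 = 2^-1 :> R by [].
by apply/andP; split; nra.
Qed.

Lemma choose_scale m0 d : (1 < d)%N ->
  exists2 m : nat, (m0 < m)%N &
  [/\ 2 ^+ 20 * d%:R <= (2 ^+ m) ^+ 16 :> R,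
      (2 ^+ m) ^+ 16 <= 2 ^+ (16 * m0 + 37) * d%:R :> R,
      Rpower.ln (INR d) <= 32 * m%:R &
      m%:R <= 2 * (m0 + 3)%:R * Rpower.ln (INR d) :> R].
Proof.
move=> d1; have d0 : (0 < d)%N by apply: leq_trans d1.
pose t := trunc_log 2 d.
have /andP[td dt] : (2 ^ t <= d < 2 ^ t.+1)%N by apply: trunc_log_bounds.
have t0 : (0 < t)%N by rewrite trunc_log_gt0.
have /andP[l1 l2] := ln_trunc_log (introT andP (conj td dt)).
(* The 21 is the headroom [2 ^+ 20] plus 1 for [d < 2 ^ t.+1]. Rounding [16 * m] past it costs at
   most 16, whence the exponent [16 * m0 + 37]. *)
pose q := ((t + 21) %/ 16)%N.
have q1 : (16 * q <= t + 21)%N by rewrite mulnC leq_divM.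
have q2 : (t + 21 < 16 * q + 16)%N by have := ltn_ceil (t + 21) (isT : (0 < 16)%N); rewrite -/q; lia.
exists (m0 + q + 1)%N; first lia.
have two1 : 1 <= 2 :> R by rewrite ler1n.
split.
- apply: (@le_trans _ _ (2 ^+ 20 * 2 ^+ t.+1)).
    by rewrite ler_pM2l ?exprn_gt0 // -natrX ler_nat ltnW.
  by rewrite -exprD -exprM ler_weXn2l //; lia.
- apply: (@le_trans _ _ (2 ^+ (16 * m0 + 37) * 2 ^+ t)).
    by rewrite -exprD -exprM ler_weXn2l //; lia.
  by rewrite ler_pM2l ?exprn_gt0 // -natrX ler_nat.
- apply: (le_trans l2); rewrite -natrM natr1 ler_nat; lia.
- apply: (@le_trans _ _ ((m0 + 3)%:R * t%:R)).
    rewrite -natrM ler_nat; nia.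
  have := ler_wpM2l (ler0n R (m0 + 3)) l1; lra.
Qed.

Lemma sketch_exists (eps : R) : 0 < eps -> eps < 1 ->
  exists c C : R, 0 < c /\ 0 < C /\
  forall d n : nat, (1 < d)%N -> (0 < n)%N ->
  exists (r : nat) (PS : prob_space) (Pi : sample PS -> nat -> nat -> R),
  [/\ r%:R <= C * d%:R ^+ 2, forall E, meas PS E,
      forall t j, (j < n)%N -> (nnz_col r (Pi t) j <= 2)%N,
      forall j, (j < n)%N ->
        expect_nat PS r (fun t => nnz_col r (Pi t) j) <= 1 + eps &
      forall A : nat -> nat -> R, 99 / 100 <= prob PS (fun t => forall x,
        Rle (Rmult (Rmult c (Rpower.ln (INR d))) (norm1 n (matvec d A x)))
            (norm1 r (matvec n (Pi t) (matvec d A x))) /\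
        Rle (norm1 r (matvec n (Pi t) (matvec d A x)))
            (Rmult (Rmult (Rmult C (INR d)) (Rpower.ln (INR d)))
              (norm1 n (matvec d A x))))].
Proof.
move=> e0 e1; have [m0 Hm0] := exists_scale e0.
have [B B1 HB] : exists2 B : R, 1 <= B & 2 ^+ (16 * m0 + 37) = B.
  by exists (2 ^+ (16 * m0 + 37)) => //; apply: exprn_ege1; rewrite ler1n.
have m3 : 1 <= (m0 + 3)%:R :> R by rewrite ler1n addnS.
(* [B ^+ 2] covers [r = 2 M^32 <= 2 (B d)^2], and [30 * (m0 + 3)] comes from
   [15 * m <= 30 * (m0 + 3) * ln d]. *)
pose C := 30 * (m0 + 3)%:R * B ^+ 2.
have BB : B <= B ^+ 2 by rewrite expr2; nra.
have C0 : 0 < C by rewrite !mulr_gt0 ?exprn_gt0 // (lt_le_trans ltr01).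
(* [1024 = 32 * 32]: the lower bound is [eps * m / 32], and [ln d <= 32 * m]. *)
exists (eps / 1024), C; split; first by rewrite divr_gt0.
split=> // d n d1 n0.
have [m mm0 [h1 h2 h3 h4]] := choose_scale m0 d1.
have [hload hdev] := Hm0 m (ltnW mm0).
have m_gt0 : (0 < m)%N by apply: leq_ltn_trans mm0.
have [PS [Pi [Hmeas Hnnz Hexp Hprob]]] := sketch_space e0 e1 m_gt0 n0 hload hdev h1.
rewrite HB in h2.
have d0 : 0 <= d%:R :> R by [].
have D0 : 0 <= (2 ^+ m) ^+ 16 :> R by rewrite !exprn_ge0.
exists (2 ^ (m * 32) + 2 ^ (m * 32))%N, PS, Pi; split => //.
  rewrite natrD natrX exprM.
  have -> : (2 ^+ m) ^+ 32 = (2 ^+ m) ^+ 16 * (2 ^+ m) ^+ 16 :> R by rewrite -exprD.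
  have : (2 ^+ m) ^+ 16 * (2 ^+ m) ^+ 16 <= (B * d%:R) * (B * d%:R) by apply: ler_pM.
  have : 0 <= (B * d%:R) ^+ 2 by apply: sqr_ge0.
  rewrite /C; move: ((2 ^+ m) ^+ 16) (d%:R) ((m0 + 3)%:R) m3 => D x y y1.
  have -> : 30 * y * B ^+ 2 * x ^+ 2 = 30 * (y * (B * x) ^+ 2) by ring.
  by rewrite expr2; move: (B * x * (B * x)) => z z0 hz; nra.
move=> A; apply: Hprob => t H x; have [lo up] := H x.
have N0 : 0 <= norm1 n (matvec d A x) by rewrite norm1E; apply: sumr_ge0.
have L0 : 0 <= Rpower.ln (INR d).
  have mp : 0 < m%:R :> R by rewrite ltr0n.
  have y0 : 0 <= 2 * (m0 + 3)%:R :> R by rewrite mulr_ge0.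
  rewrite leNgt; apply/negP => l0.
  by have := mulr_ge0_le0 y0 (ltW l0); rewrite leNgt (lt_le_trans mp h4).
rewrite INRE in h3 h4 L0; split; apply/RleP; rewrite !RmultE INRE.
  apply: le_trans lo; apply: ler_wpM2r => //.
  by have := ler_wpM2l (ltW e0) h3; lra.
apply: (le_trans up); apply: ler_wpM2r => //.
move: (Rpower.ln _) L0 h4 => l l0 h4.
apply: (@le_trans _ _ (15 * (2 * (m0 + 3)%:R * l) * (B * d%:R))).
  by apply: ler_pM => //; [rewrite mulr_ge0 | rewrite ler_pM2l].
have -> : 15 * (2 * (m0 + 3)%:R * l) * (B * d%:R) = 30 * (m0 + 3)%:R * d%:R * l * B.
  by ring.
have -> : C * d%:R * l = 30 * (m0 + 3)%:R * d%:R * l * B ^+ 2 by rewrite /C; ring.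
by apply: ler_wpM2l => //; rewrite !mulr_ge0.
Qed.

(* Gives back to [<=] and [<] on nat their Prop-valued meaning. *)
Import Corelib.Init.Peano.
From Stdlib Require Import Reals.
Open Scope R_scope.

Theorem theorem7 :
  forall eps : R, 0 < eps < 1 ->
  exists c C : R, 0 < c /\ 0 < C /\
  forall d n : nat, (2 <= d)%nat -> (1 <= n)%nat ->
  exists (r : nat) (PS : prob_space) (Pi : sample PS -> nat -> nat -> R),
    (* r <= C d^2 *)
    INR r <= C * INR d ^ 2 /\
    (* Pi is a random r x n matrix (each entry Borel measurable) *)
    (forall (i j : nat) (a : R), (i < r)%nat -> (j < n)%nat ->
        meas PS (fun w => Pi w i j <= a)) /\
    (* every matrix in the support has at most two non-zeros per column *)
    (forall (w : sample PS) (j : nat), (j < n)%nat -> (nnz_col r (Pi w) j <= 2)%nat) /\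
    (* expected number of non-zeros in each column is at most 1 + eps *)
    (forall j : nat, (j < n)%nat ->
        (forall k : nat, meas PS (fun w => nnz_col r (Pi w) j = k)) /\
        expect_nat PS r (fun w => nnz_col r (Pi w) j) <= 1 + eps) /\
    (* for every fixed n x d matrix A, with probability >= 0.99, for all x *)
    (forall A : nat -> nat -> R,
        let good := fun w : sample PS =>
          forall x : nat -> R,
            c * ln (INR d) * norm1 n (matvec d A x)
              <= norm1 r (matvec n (Pi w) (matvec d A x)) /\
            norm1 r (matvec n (Pi w) (matvec d A x))
              <= C * INR d * ln (INR d) * norm1 n (matvec d A x) in
        meas PS good /\ 99 / 100 <= prob PS good).
Proof.
move=> eps [/RltP e0 /RltP e1].
have [c [C [/RltP c0 [/RltP C0 H]]]] := sketch_exists e0 e1.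
exists c, C; split; [exact: c0 | split; [exact: C0 |]].
move=> d n /ssrnat.leP d2 /ssrnat.leP n1.
have [r [PS [Pi [Hr Hmeas Hnnz Hexp Hprob]]]] := H d n d2 n1.
exists r, PS, Pi; split; [|split; [|split; [|split]]].
- by apply/RleP; rewrite RmultE RpowE !INRE.
- by move=> i j a _ _; apply: Hmeas.
- by move=> t j /ssrnat.ltP jn; apply/ssrnat.leP; apply: Hnnz.
- move=> j /ssrnat.ltP jn; split; first by move=> k; apply: Hmeas.
  by apply/RleP; apply: Hexp.
move=> A good; split; first exact: Hmeas.
by apply/RleP; rewrite RdivE !IZRposE !INRE; apply: Hprob.
Qed.
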